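(* Let $n\ge 1$ and let $\sigma_1,\dots,\sigma_n\in\bar{U}(n)$. The ring $\mathrm{Diff}_{\mathbf h}(\sigma_1,\dots,\sigma_n)$ satisfies the Poincaré–Birkhoff–Witt property if and only if the elements $\sigma_1,\dots,\sigma_n$ satisfy the linear system of finite-difference equations $$\tilde h_{ij}\,\Delta_j\sigma_i=\sigma_i-\sigma_j,\qquad i,j=1,\dots,n.$$
   Context: $\mathbb K$ is a field of characteristic $0$. $U(n)=\mathbb K[\tilde h_1,\dots,\tilde h_n]$ is the commutative polynomial ring, $\tilde h_{ij}=\tilde h_i-\tilde h_j$, and $\bar U(n)$ is the localization of $U(n)$ with respect to the multiplicative set generated by all $\tilde h_{ij}+a$, $a\in\mathbb Z$, $i\ne j$. For $p\in\bar U(n)$, $p[\pm\varepsilon_j]$ denotes the image of $p$ under the automorphism $\tilde h_i\mapsto\tilde h_i\pm\delta_{ij}$ ($i=1,\dots,n$). $\Delta_j f:=f-f[-\varepsilon_j]$. For $\sigma_1,\dots,\sigma_n\in\bar U(n)$ the ring $\mathrm{Diff}_{\mathbf h}(\sigma_1,\dots,\sigma_n)$ is the ring generated over $\bar U(n)$ by $x^i,\bar\partial_i$, $i=1,\dots,n$, with the defining relations (weight relations) $\tilde h_i x^j=x^j(\tilde h_i+\delta_{ij})$, $\tilde h_i\bar\partial_j=\bar\partial_j(\tilde h_i-\delta_{ij})$ for all $i,j$ (hence $p\,x^j=x^j\,p[\varepsilon_j]$, $p\,\bar\partial_j=\bar\partial_j\,p[-\varepsilon_j]$ for $p\in\bar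 U(n)$), together with $$x^ix^j=\frac{\tilde h_{ij}+1}{\tilde h_{ij}}x^jx^i,\qquad \bar\partial_i\bar\partial_j=\frac{\tilde h_{ij}-1}{\tilde h_{ij}}\bar\partial_j\bar\partial_i\qquad(i<j),$$ $$x^i\bar\partial_j=\bar\partial_jx^i\ \ (i<j),\qquad x^i\bar\partial_j=\frac{\tilde h_{ij}(\tilde h_{ij}-2)}{(\tilde h_{ij}-1)^2}\bar\partial_jx^i\ \ (i>j),$$ $$x^i\bar\partial_i=\sum_{j=1}^n\frac{1}{1-\tilde h_{ij}}\bar\partial_jx^j-\sigma_i,\qquad i=1,\dots,n.$$ The Poincaré–Birkhoff–Witt property means that the ring is isomorphic, as a $\bar U(n)$-module, to $V^*(n)\otimes_{\bar U(n)}V(n)$ via multiplication, where $V(n)$ is the ring generated over $\bar U(n)$ by $x^1,\dots,x^n$ with the defining relations $\tilde h_i x^j=x^j(\tilde h_i+\delta_{ij})$ for all $i,j$ and $x^ix^j=\frac{\tilde h_{ij}+1}{\tilde h_{ij}}x^jx^i$ for $i<j$, and $V^*(n)$ is the ring generated over $\bar U(n)$ by $\bar\partial_1,\dots,\bar\partial_n$ with the defining relations $\tilde h_i\bar\partial_j=\bar\partial_j(\tilde h_i-\delta_{ij})$ for all $i,j$ and $\bar\partial_i\bar\partial_j=\frac{\tilde h_{ij}-1}{\tilde h_{ij}}\bar\partial_j\bar\partial_i$ for $i<j$; equivalently, the ordered monomials $\bar\partial_1^{a_1}\cdots\bar\partial_n^{a_n}(x^1)^{b_1}\cdots(x^n)^{b_n}$,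 $a_i,b_i\in\mathbb Z_{\ge0}$, form a basis of the left $\bar U(n)$-module. *)

(* Defs.v *)
From HB Require Import structures.
From mathcomp Require Import all_boot all_order all_algebra.
From mathcomp Require Import generic_quotient fraction.
From mathcomp Require Import boolp mpoly.

Set Implicit Arguments.
Unset Strict Implicit.
Unset Printing Implicit Defensive.

Import GRing.Theory.
Local Open Scope ring_scope.

Section Localization.
Variables (K : fieldType) (n : nat).
Local Notation P := {mpoly K[n]}.
Local Notation Q := {fraction P}.
Local Notation "p %:F" := (@FracField.tofrac P p).

Inductive denominator : P -> Prop :=
| denominator1 : denominator 1
| denominatorM (i j : 'I_n) (a : int) (s : P) : i != j -> denominator s ->
    denominator (('X_i - 'X_j + a%:~R) * s).

(* U(n) is a domain and no denominator vanishes, so the localization is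
   a subring of the field of fractions. *)
Definition Ubar_pred : {pred Q} :=
  fun f => `[< exists p s, denominator s /\ f = p%:F / s%:F >].

Lemma factor_neq0 (i j : 'I_n) (a : int) :
  i != j -> 'X_i - 'X_j + a%:~R != 0 :> P.
Proof.
move=> ij; apply/eqP => /(congr1 (mcoeff U_(i))).
rewrite mcoeffD mcoeffB !mcoeffX mcoeff0 -(rmorph_int (@mpolyC n K)) mcoeffC.
rewrite eqxx mnm1_eq0 mulr0 addr0.
have -> : (U_(j) == U_(i))%MM = false.
  apply/negbTE; apply: contra ij => /eqP/mnmP/(_ i).
  by rewrite !mnm1E eqxx eq_sym; case: eqP.
by rewrite subr0 => /eqP; rewrite oner_eq0.
Qed.

Lemma denominator_neq0 (s : P) : denominator s -> s != 0.
Proof.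
elim=> [|i j a t ij _ t0]; first exact: oner_neq0.
by rewrite mulf_neq0 // factor_neq0.
Qed.

Lemma denominator_mul (s t : P) :
  denominator s -> denominator t -> denominator (s * t).
Proof.
by elim=> [|i j a u ij _ IH] ht; rewrite ?mul1r // -mulrA; apply: denominatorM (IH ht).
Qed.

Lemma Ubar_subring : subring_closed Ubar_pred.
Proof.
split.
- apply/asboolP; exists 1, 1; split; first exact: denominator1.
  by rewrite tofrac1 divr1.
- move=> f g /asboolP[p [s [hs ->]]] /asboolP[q [t [ht ->]]].
  apply/asboolP; exists (p * t - q * s), (s * t).
  split; first exact: denominator_mul.
  rewrite tofracB !tofracM -mulNr addf_div ?tofrac_eq0 ?denominator_neq0 //.
  by rewrite mulNr.
- move=> f g /asboolP[p [s [hs ->]]] /asboolP[q [t [ht ->]]].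
  apply/asboolP; exists (p * q), (s * t).
  split; first exact: denominator_mul.
  by rewrite !tofracM mulf_div.
Qed.

HB.instance Definition _ := GRing.isSubringClosed.Build Q Ubar_pred Ubar_subring.

Record Ubar : Type := MkUbar { Ubar_val :> Q; _ : Ubar_val \in Ubar_pred }.

HB.instance Definition _ := [isSub for Ubar_val].
HB.instance Definition _ := [Choice of Ubar by <:].
HB.instance Definition _ := [SubChoice_isSubComNzRing of Ubar by <:].

Definition Ubar_unit : {pred Ubar} :=
  fun u => (Ubar_val u != 0) && ((Ubar_val u)^-1 \in Ubar_pred).
Definition Ubar_inv (u : Ubar) : Ubar :=
  if u \in Ubar_unit then insubd u (Ubar_val u)^-1 else u.

Lemma Ubar_invE (u : Ubar) : u \in Ubar_unit ->
  Ubar_val (Ubar_inv u) = (Ubar_val u)^-1.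
Proof.
move=> hu; rewrite /Ubar_inv hu; case/andP: hu => _ hu.
by have := @insubdK _ _ Ubar u _ hu.
Qed.

Lemma Ubar_mulVr : {in Ubar_unit, left_inverse 1 Ubar_inv *%R}.
Proof.
move=> u hu; apply: val_inj; rewrite rmorphM rmorph1 /= Ubar_invE //.
by rewrite mulVf //; case/andP: hu.
Qed.

Lemma Ubar_unitP (u v : Ubar) : v * u = 1 -> u \in Ubar_unit.
Proof.
move=> /(congr1 val); rewrite rmorphM rmorph1 /= => vu.
have u0 : Ubar_val u != 0.
  by apply/eqP => u0; move/eqP: vu; rewrite u0 mulr0 eq_sym oner_eq0.
rewrite unfold_in u0 /=.
have -> : (Ubar_val u)^-1 = Ubar_val v by apply: (mulIf u0); rewrite vu mulVf.
exact: (valP v).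
Qed.

Lemma Ubar_inv_out : {in [predC Ubar_unit], Ubar_inv =1 id}.
Proof. by move=> u; rewrite inE /Ubar_inv => /negbTE ->. Qed.

HB.instance Definition _ := GRing.ComNzRing_hasMulInverse.Build Ubar
  Ubar_mulVr Ubar_unitP Ubar_inv_out.

Lemma poly_Ubar (p : P) : p%:F \in Ubar_pred.
Proof.
by apply/asboolP; exists p, 1; split; [constructor | rewrite tofrac1 divr1].
Qed.
Definition Ubar_of (p : P) : Ubar := MkUbar (poly_Ubar p).

Lemma Ubar_of_zmod_morphism : zmod_morphism Ubar_of.
Proof. by move=> p q; apply: val_inj; rewrite /= tofracB. Qed.
Lemma Ubar_of_monoid_morphism : monoid_morphism Ubar_of.
Proof. by split=> [|p q]; apply: val_inj; rewrite /= ?tofrac1 ?tofracM. Qed.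
HB.instance Definition _ :=
  GRing.isZmodMorphism.Build P Ubar Ubar_of Ubar_of_zmod_morphism.
HB.instance Definition _ :=
  GRing.isMonoidMorphism.Build P Ubar Ubar_of Ubar_of_monoid_morphism.

Definition htilde (i : 'I_n) : Ubar := Ubar_of 'X_i.
Definition hdiff (i j : 'I_n) : Ubar := htilde i - htilde j.
Definition Ubar_scalar (c : K) : Ubar := Ubar_of c%:MP.

Lemma hdiffD_unit (i j : 'I_n) (a : int) :
  i != j -> hdiff i j + a%:~R \is a GRing.unit.
Proof.
move=> ij; have -> : hdiff i j + a%:~R = Ubar_of ('X_i - 'X_j + a%:~R).
  by rewrite [RHS]rmorphD rmorphB rmorph_int.
have f0 := factor_neq0 a ij.
suff : Ubar_of ('X_i - 'X_j + a%:~R) \in Ubar_unit by [].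
rewrite unfold_in /= tofrac_eq0 f0 /=; apply/asboolP.
exists 1, ('X_i - 'X_j + a%:~R); split; last by rewrite tofrac1 mul1r.
by rewrite -[X in denominator X]mulr1; apply: denominatorM => //; constructor.
Qed.

Section Shift.
Variables (j : 'I_n) (a : int).

Definition shift_poly (b : int) (p : P) : P :=
  p \mPo [tuple 'X_k + (b *+ (k == j))%:~R | k < n].

HB.instance Definition _ b := GRing.RMorphism.copy (shift_poly b)
  (comp_mpoly [tuple 'X_k + (b *+ (k == j))%:~R | k < n]).

Lemma shift_polyX b i : shift_poly b 'X_i = 'X_i + (b *+ (i == j))%:~R.
Proof. by rewrite /shift_poly comp_mpolyXU -tnth_nth tnth_mktuple. Qed.

Lemma shift_polyC b c : shift_poly b c%:MP = c%:MP.
Proof. by rewrite /shift_poly comp_mpolyC. Qed.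

Lemma shift_polyK b : cancel (shift_poly b) (shift_poly (- b)).
Proof.
move=> p; rewrite [in LHS](mpolyE p) (rmorph_sum (shift_poly b)).
rewrite (rmorph_sum (shift_poly (- b))) [RHS](mpolyE p).
apply: eq_bigr => m _; rewrite -mul_mpolyC.
rewrite (rmorphM (shift_poly b)) (rmorphM (shift_poly (- b))) /= !shift_polyC.
congr (_ * _); rewrite mpolyXE_id (rmorph_prod (shift_poly b)).
rewrite (rmorph_prod (shift_poly (- b))); apply: eq_bigr => i _.
rewrite (rmorphXn (shift_poly b)) (rmorphXn (shift_poly (- b))) /= shift_polyX.
congr (_ ^+ _); rewrite (rmorphD (shift_poly (- b))) /= shift_polyX.
by rewrite (rmorph_int (shift_poly (- b))) mulNrn mulrNz subrK.
Qed.

Lemma shift_poly_eq0 b p : (shift_poly b p == 0) = (p == 0).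
Proof.
by rewrite -[RHS](can_eq (shift_polyK b)) (rmorph0 (shift_poly b)).
Qed.

Local Open Scope quotient_scope.

Lemma frac_repr (f : Q) : f = (\n_(repr f))%:F / (\d_(repr f))%:F.
Proof.
have d0 : (\d_(repr f))%:F != 0 by rewrite tofrac_eq0; apply: denom_ratioP.
apply: (mulIf d0); rewrite divfK // -{1}[f]reprK; unlock FracField.tofrac.
rewrite -[LHS]FracField.pi_mul; apply/eqmodP; rewrite /= FracField.equivfE.
rewrite /FracField.mulf !numden_Ratio ?mulf_neq0 ?oner_eq0 //; try exact: denom_ratioP.
by rewrite !mulr1 mulrC.
Qed.

(* Independent of the chosen representative: see shift_fracE. *)
Definition shift_frac (f : Q) : Q :=
  (shift_poly a \n_(repr f))%:F / (shift_poly a \d_(repr f))%:F.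

Lemma shift_fracE (p s : P) : s != 0 ->
  shift_frac (p%:F / s%:F) = (shift_poly a p)%:F / (shift_poly a s)%:F.
Proof.
move=> s0; rewrite /shift_frac; set r := repr _.
have := frac_repr (p%:F / s%:F); rewrite -/r => /eqP.
have d0 : \d_r != 0 by apply: denom_ratioP.
rewrite eqr_div ?tofrac_eq0 // -!tofracM tofrac_eq => /eqP e.
apply/eqP; rewrite eqr_div ?tofrac_eq0 ?shift_poly_eq0 //.
by rewrite -!tofracM tofrac_eq -!(rmorphM (shift_poly a)) e.
Qed.

Lemma shift_denominator (s : P) : denominator s -> denominator (shift_poly a s).
Proof.
elim=> [|i k b t ik _ IH]; first by rewrite rmorph1; constructor.
rewrite (rmorphM (shift_poly a)) /= rmorphD rmorphB rmorph_int /= !shift_polyX.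
have -> : 'X_i + (a *+ (i == j))%:~R - ('X_k + (a *+ (k == j))%:~R) + b%:~R
  = 'X_i - 'X_k + (a *+ (i == j) - a *+ (k == j) + b)%:~R :> P.
  by rewrite mulrzDr mulrzBr opprD addrACA [RHS]addrA.
exact: denominatorM.
Qed.

Lemma shift_frac_in (u : Ubar) : shift_frac u \in Ubar_pred.
Proof.
have /asboolP[p [s [hs ->]]] := valP u.
rewrite shift_fracE ?denominator_neq0 //; apply/asboolP.
by exists (shift_poly a p), (shift_poly a s); split=> //; apply: shift_denominator.
Qed.

(* The automorphism u |-> u[a e_j], sending h_i to h_i + a delta_ij. *)
Definition Ubar_shift (u : Ubar) : Ubar := MkUbar (shift_frac_in u).

Lemma shift_of (p : P) : Ubar_shift (Ubar_of p) = Ubar_of (shift_poly a p).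
Proof.
apply: val_inj; rewrite /= -[p%:F]divr1 -tofrac1 shift_fracE ?oner_neq0 //.
by rewrite rmorph1 tofrac1 divr1.
Qed.

Lemma shift_zmod_morphism : zmod_morphism Ubar_shift.
Proof.
move=> u v; apply: val_inj; rewrite /=.
have /asboolP[p [s [/denominator_neq0 hs ->]]] := valP u.
have /asboolP[q [t [/denominator_neq0 ht ->]]] := valP v.
rewrite -mulNr addf_div ?tofrac_eq0 // -tofracN -!tofracM -tofracD.
rewrite !shift_fracE ?mulf_neq0 // rmorphD !rmorphM rmorphN /=.
rewrite -mulNr addf_div ?tofrac_eq0 ?shift_poly_eq0 //.
by rewrite tofracD !tofracM tofracN.
Qed.

Lemma shift_monoid_morphism : monoid_morphism Ubar_shift.
Proof.
split=> [|u v].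
  by rewrite -[1 in LHS](rmorph1 Ubar_of) shift_of !rmorph1.
apply: val_inj; rewrite /=.
have /asboolP[p [s [/denominator_neq0 hs ->]]] := valP u.
have /asboolP[q [t [/denominator_neq0 ht ->]]] := valP v.
rewrite mulf_div -!tofracM !shift_fracE ?mulf_neq0 // !rmorphM /=.
by rewrite mulf_div.
Qed.

HB.instance Definition _ :=
  GRing.isZmodMorphism.Build Ubar Ubar Ubar_shift shift_zmod_morphism.
HB.instance Definition _ :=
  GRing.isMonoidMorphism.Build Ubar Ubar Ubar_shift shift_monoid_morphism.

Lemma Ubar_shift_h i : Ubar_shift (htilde i) = htilde i + (a *+ (i == j))%:~R.
Proof. by rewrite shift_of shift_polyX rmorphD rmorph_int. Qed.

End Shift.

Definition Delta (j : 'I_n) (f : Ubar) : Ubar := f - Ubar_shift j (-1) f.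

End Localization.
Local Open Scope quotient_scope.

(* Terms for the ring generated over R by G; R is not assumed central. *)
Inductive gterm (R G : Type) : Type :=
| TConst of R
| TGen of G
| TAdd of gterm R G & gterm R G
| TOpp of gterm R G
| TMul of gterm R G & gterm R G.
Arguments TConst {R G}.
Arguments TGen {R G}.

Declare Scope gterm_scope.
Delimit Scope gterm_scope with T.
Bind Scope gterm_scope with gterm.
Notation "s + t" := (TAdd s t) : gterm_scope.
Notation "- t" := (TOpp t) : gterm_scope.
Notation "s - t" := (TAdd s (TOpp t)) : gterm_scope.
Notation "s * t" := (TMul s t) : gterm_scope.

Section PresentedRing.
Variables (R : pzRingType) (G : Type).
Local Notation term := (gterm R G).
Variable rels : term -> term -> Prop.

(* The least ring congruence on terms for which [TConst] is a ring morphism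
   and which contains [rels]. *)
Inductive gcongr : term -> term -> Prop :=
| gcongr_rel s t : rels s t -> gcongr s t
| gcongr_refl s : gcongr s s
| gcongr_sym s t : gcongr s t -> gcongr t s
| gcongr_trans s t u : gcongr s t -> gcongr t u -> gcongr s u
| gcongr_add s s' t t' : gcongr s s' -> gcongr t t' -> gcongr (s + t) (s' + t')
| gcongr_opp s s' : gcongr s s' -> gcongr (- s) (- s')
| gcongr_mul s s' t t' : gcongr s s' -> gcongr t t' -> gcongr (s * t) (s' * t')
| gcongr_addA s t u : gcongr (s + (t + u)) (s + t + u)
| gcongr_addC s t : gcongr (s + t) (t + s)
| gcongr_add0 s : gcongr (TConst 0 + s) s
| gcongr_addN s : gcongr (- s + s) (TConst 0)
| gcongr_mulA s t u : gcongr (s * (t * u)) (s * t * u)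
| gcongr_mul1l s : gcongr (TConst 1 * s) s
| gcongr_mul1r s : gcongr (s * TConst 1) s
| gcongr_mulDl s t u : gcongr ((s + t) * u) (s * u + t * u)
| gcongr_mulDr s t u : gcongr (s * (t + u)) (s * t + s * u)
| gcongr_constD a b : gcongr (TConst (a + b)) (TConst a + TConst b)
| gcongr_constM a b : gcongr (TConst (a * b)) (TConst a * TConst b).

Definition gcongrb : rel {classic term} := fun s t => `[< gcongr s t >].

Lemma gcongrb_refl : reflexive gcongrb.
Proof. by move=> s; apply/asboolP; apply: gcongr_refl. Qed.
Lemma gcongrb_sym : ssrbool.symmetric gcongrb.
Proof. by move=> s t; apply/asboolP/asboolP => /gcongr_sym. Qed.
Lemma gcongrb_trans : transitive gcongrb.
Proof.
move=> t s u /asboolP st /asboolP tu; apply/asboolP.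
exact: gcongr_trans st tu.
Qed.
Canonical gcongr_equiv := EquivRel gcongrb gcongrb_refl gcongrb_sym gcongrb_trans.

Definition presented : Type := {eq_quot gcongr_equiv}.
HB.instance Definition _ := Choice.on presented.
HB.instance Definition _ : EqQuotient _ gcongr_equiv presented :=
  EqQuotient.on presented.

Definition gclass (s : term) : presented := \pi_presented (s : {classic term}).
Definition grepr (x : presented) : term := repr x.

Lemma greprK x : gclass (grepr x) = x.
Proof. exact: reprK. Qed.
Lemma gclassP s t : gclass s = gclass t <-> gcongr s t.
Proof.
split; first by move=> /eqmodP/asboolP.
by move=> st; apply/eqmodP/asboolP.
Qed.
Lemma grepr_class s : gcongr (grepr (gclass s)) s.
Proof. by apply/gclassP; rewrite greprK. Qed.

Definition gadd x y := gclass (grepr x + grepr y).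
Definition gopp x := gclass (- grepr x).
Definition gmul x y := gclass (grepr x * grepr y).
Definition gconst (a : R) := gclass (TConst a).
Definition ggen (g : G) := gclass (TGen g).

Lemma gclassD s t : gclass (s + t) = gadd (gclass s) (gclass t).
Proof. by apply/gclassP/gcongr_add; apply/gcongr_sym/grepr_class. Qed.
Lemma gclassN s : gclass (- s) = gopp (gclass s).
Proof. by apply/gclassP/gcongr_opp; apply/gcongr_sym/grepr_class. Qed.
Lemma gclassM s t : gclass (s * t) = gmul (gclass s) (gclass t).
Proof. by apply/gclassP/gcongr_mul; apply/gcongr_sym/grepr_class. Qed.

Lemma gaddA : associative gadd.
Proof.
move=> x y z; rewrite -[x]greprK -[y]greprK -[z]greprK -!gclassD.
exact/gclassP/gcongr_addA.
Qed.
Lemma gaddC : commutative gadd.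
Proof. by move=> x y; apply/gclassP/gcongr_addC. Qed.
Lemma gadd0 : left_id (gconst 0) gadd.
Proof. by move=> x; rewrite -[x]greprK -gclassD; apply/gclassP/gcongr_add0. Qed.
Lemma gaddN : left_inverse (gconst 0) gopp gadd.
Proof.
by move=> x; rewrite -[x]greprK -gclassN -gclassD; apply/gclassP/gcongr_addN.
Qed.
HB.instance Definition _ := GRing.isZmodule.Build presented gaddA gaddC gadd0 gaddN.

Lemma gmulA : associative gmul.
Proof.
move=> x y z; rewrite -[x]greprK -[y]greprK -[z]greprK -!gclassM.
exact/gclassP/gcongr_mulA.
Qed.
Lemma gmul1l : left_id (gconst 1) gmul.
Proof. by move=> x; rewrite -[x]greprK -gclassM; apply/gclassP/gcongr_mul1l. Qed.
Lemma gmul1r : right_id (gconst 1) gmul.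
Proof. by move=> x; rewrite -[x]greprK -gclassM; apply/gclassP/gcongr_mul1r. Qed.
Lemma gmulDl : left_distributive gmul gadd.
Proof.
move=> x y z; rewrite -[x]greprK -[y]greprK -[z]greprK -!(gclassD, gclassM).
exact/gclassP/gcongr_mulDl.
Qed.
Lemma gmulDr : right_distributive gmul gadd.
Proof.
move=> x y z; rewrite -[x]greprK -[y]greprK -[z]greprK -!(gclassD, gclassM).
exact/gclassP/gcongr_mulDr.
Qed.
HB.instance Definition _ :=
  GRing.Zmodule_isPzRing.Build presented gmulA gmul1l gmul1r gmulDl gmulDr.

Lemma gclass_add s t : gclass (s + t) = (gclass s + gclass t)%R.
Proof. exact: gclassD. Qed.
Lemma gclass_opp s : gclass (- s) = (- gclass s)%R.
Proof. exact: gclassN. Qed.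
Lemma gclass_mul s t : gclass (s * t) = (gclass s * gclass t)%R.
Proof. exact: gclassM. Qed.

Lemma gconst_zmod_morphism : zmod_morphism gconst.
Proof.
have cD a b : gconst (a + b) = (gconst a + gconst b)%R.
  by rewrite -gclass_add; apply/gclassP/gcongr_constD.
by move=> a b; apply/eqP; rewrite eq_sym subr_eq -cD subrK.
Qed.
Lemma gconst_monoid_morphism : monoid_morphism gconst.
Proof.
by split=> // a b; rewrite -gclass_mul; apply/gclassP/gcongr_constM.
Qed.
HB.instance Definition _ :=
  GRing.isZmodMorphism.Build R presented gconst gconst_zmod_morphism.
HB.instance Definition _ :=
  GRing.isMonoidMorphism.Build R presented gconst gconst_monoid_morphism.

Definition gscale (a : R) (x : presented) : presented := (gconst a * x)%R.
Lemma gscaleA a b x : gscale a (gscale b x) = gscale (a * b) x.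
Proof. by rewrite /gscale mulrA -rmorphM. Qed.
Lemma gscale1 : left_id 1%R gscale.
Proof. by move=> x; rewrite /gscale rmorph1 mul1r. Qed.
Lemma gscaleDr : right_distributive gscale +%R.
Proof. by move=> a x y; rewrite /gscale mulrDr. Qed.
Lemma gscaleDl x : {morph gscale^~ x : a b / (a + b)%R}.
Proof. by move=> a b; rewrite /gscale rmorphD mulrDl. Qed.
HB.instance Definition _ := GRing.Zmodule_isLmodule.Build R presented
  gscaleA gscale1 gscaleDr gscaleDl.

Section Lift.
Variables (S : pzRingType) (f : {rmorphism R -> S}) (g : G -> S).

Fixpoint geval (t : term) : S :=
  match t with
  | TConst a => f a
  | TGen x => g x
  | TAdd s t => (geval s + geval t)%R
  | TOpp s => (- geval s)%R
  | TMul s t => (geval s * geval t)%R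
  end.

Hypothesis geval_rel : forall s t, rels s t -> geval s = geval t.

Lemma geval_congr s t : gcongr s t -> geval s = geval t.
Proof.
elim=> //=.
- by move=> u v w _ -> _ ->.
- by move=> u u' v v' _ -> _ ->.
- by move=> u u' _ ->.
- by move=> u u' v v' _ -> _ ->.
- by move=> *; rewrite addrA.
- by move=> *; rewrite addrC.
- by move=> *; rewrite rmorph0 add0r.
- by move=> *; rewrite rmorph0 addNr.
- by move=> *; rewrite mulrA.
- by move=> *; rewrite rmorph1 mul1r.
- by move=> *; rewrite rmorph1 mulr1.
- by move=> *; rewrite mulrDl.
- by move=> *; rewrite mulrDr.
- by move=> *; rewrite rmorphD.
- by move=> *; rewrite rmorphM.
Qed.

Definition glift of (forall s t, rels s t -> geval s = geval t) :=
  fun x : presented => geval (grepr x).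

Lemma glift_class t : glift geval_rel (gclass t) = geval t.
Proof. exact/geval_congr/grepr_class. Qed.
Lemma glift_const a : glift geval_rel (gconst a) = f a.
Proof. exact: glift_class. Qed.
Lemma glift_gen x : glift geval_rel (ggen x) = g x.
Proof. exact: glift_class. Qed.

Lemma glift_zmod_morphism : zmod_morphism (glift geval_rel).
Proof.
by move=> x y; rewrite -[x]greprK -[y]greprK -gclass_opp -gclass_add !glift_class.
Qed.
Lemma glift_monoid_morphism : monoid_morphism (glift geval_rel).
Proof.
split=> [|x y]; first by rewrite glift_const rmorph1.
by rewrite -[x]greprK -[y]greprK -gclass_mul !glift_class.
Qed.
HB.instance Definition _ := GRing.isZmodMorphism.Build presented S
  (glift geval_rel) glift_zmod_morphism.
HB.instance Definition _ := GRing.isMonoidMorphism.Build presented S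
  (glift geval_rel) glift_monoid_morphism.
End Lift.
End PresentedRing.

Fixpoint gmap (R G G' : Type) (e : G -> G') (t : gterm R G) : gterm R G' :=
  match t with
  | TConst a => TConst a
  | TGen g => TGen (e g)
  | TAdd s t => TAdd (gmap e s) (gmap e t)
  | TOpp s => TOpp (gmap e s)
  | TMul s t => TMul (gmap e s) (gmap e t)
  end.

Lemma geval_gmap (R : pzRingType) (G G' : Type)
    (rels : gterm R G' -> gterm R G' -> Prop) (e : G -> G') (t : gterm R G) :
  geval (gconst rels) (fun g => ggen rels (e g)) t = gclass rels (gmap e t).
Proof.
elim: t => //= [s -> t ->|s ->|s -> t ->]; first by rewrite gclass_add.
- by rewrite gclass_opp.
- by rewrite gclass_mul.
Qed.

Arguments gconst {R G} rels a.
Arguments ggen {R G} rels g.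

Inductive tterm (S T : Type) : Type :=
| TenZero
| TenPure of S & T
| TenAdd of tterm S T & tterm S T
| TenOpp of tterm S T.
Arguments TenZero {S T}.

Section Tensor.
Variables (R S T : pzRingType) (f : {rmorphism R -> S}) (g : {rmorphism R -> T}).

(* S is a right R-module through f and T is a left R-module through g. *)
Inductive tcongr : tterm S T -> tterm S T -> Prop :=
| tcongr_refl s : tcongr s s
| tcongr_sym s t : tcongr s t -> tcongr t s
| tcongr_trans s t u : tcongr s t -> tcongr t u -> tcongr s u
| tcongr_add s s' t t' : tcongr s s' -> tcongr t t' ->
    tcongr (TenAdd s t) (TenAdd s' t')
| tcongr_opp s s' : tcongr s s' -> tcongr (TenOpp s) (TenOpp s')
| tcongr_addA s t u : tcongr (TenAdd s (TenAdd t u)) (TenAdd (TenAdd s t) u)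
| tcongr_addC s t : tcongr (TenAdd s t) (TenAdd t s)
| tcongr_add0 s : tcongr (TenAdd TenZero s) s
| tcongr_addN s : tcongr (TenAdd (TenOpp s) s) TenZero
| tcongr_pureDl a a' b :
    tcongr (TenPure (a + a') b) (TenAdd (TenPure a b) (TenPure a' b))
| tcongr_pureDr a b b' :
    tcongr (TenPure a (b + b')) (TenAdd (TenPure a b) (TenPure a b'))
| tcongr_balanced a r b : tcongr (TenPure (a * f r) b) (TenPure a (g r * b)).

Definition tcongrb : rel {classic tterm S T} := fun s t => `[< tcongr s t >].

Lemma tcongrb_refl : reflexive tcongrb.
Proof. by move=> s; apply/asboolP; apply: tcongr_refl. Qed.
Lemma tcongrb_sym : ssrbool.symmetric tcongrb.
Proof. by move=> s t; apply/asboolP/asboolP => /tcongr_sym. Qed.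
Lemma tcongrb_trans : transitive tcongrb.
Proof.
move=> t s u /asboolP st /asboolP tu; apply/asboolP.
exact: tcongr_trans st tu.
Qed.
Canonical tcongr_equiv := EquivRel tcongrb tcongrb_refl tcongrb_sym tcongrb_trans.

Definition tensor : Type := {eq_quot tcongr_equiv}.
HB.instance Definition _ := Choice.on tensor.
HB.instance Definition _ : EqQuotient _ tcongr_equiv tensor :=
  EqQuotient.on tensor.

Definition tclass (s : tterm S T) : tensor := \pi_tensor (s : {classic tterm S T}).
Definition trepr (x : tensor) : tterm S T := repr x.

Lemma treprK x : tclass (trepr x) = x.
Proof. exact: reprK. Qed.
Lemma tclassP s t : tclass s = tclass t <-> tcongr s t.
Proof.
split; first by move=> /eqmodP/asboolP.
by move=> st; apply/eqmodP/asboolP.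
Qed.
Lemma trepr_class s : tcongr (trepr (tclass s)) s.
Proof. by apply/tclassP; rewrite treprK. Qed.

Definition tadd x y := tclass (TenAdd (trepr x) (trepr y)).
Definition topp x := tclass (TenOpp (trepr x)).
Definition pure (a : S) (b : T) : tensor := tclass (TenPure a b).

Lemma tclassD s t : tclass (TenAdd s t) = tadd (tclass s) (tclass t).
Proof. by apply/tclassP/tcongr_add; apply/tcongr_sym/trepr_class. Qed.
Lemma tclassN s : tclass (TenOpp s) = topp (tclass s).
Proof. by apply/tclassP/tcongr_opp; apply/tcongr_sym/trepr_class. Qed.

Lemma taddA : associative tadd.
Proof.
move=> x y z; rewrite -[x]treprK -[y]treprK -[z]treprK -!tclassD.
exact/tclassP/tcongr_addA.
Qed.
Lemma taddC : commutative tadd.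
Proof. by move=> x y; apply/tclassP/tcongr_addC. Qed.
Lemma tadd0 : left_id (tclass TenZero) tadd.
Proof. by move=> x; rewrite -[x]treprK -tclassD; apply/tclassP/tcongr_add0. Qed.
Lemma taddN : left_inverse (tclass TenZero) topp tadd.
Proof.
by move=> x; rewrite -[x]treprK -tclassN -tclassD; apply/tclassP/tcongr_addN.
Qed.
HB.instance Definition _ := GRing.isZmodule.Build tensor taddA taddC tadd0 taddN.

Lemma tclass_add s t : tclass (TenAdd s t) = tclass s + tclass t.
Proof. exact: tclassD. Qed.
Lemma tclass_opp s : tclass (TenOpp s) = - tclass s.
Proof. exact: tclassN. Qed.

Lemma tensor_ind (Q : tensor -> Prop) :
  Q 0 -> (forall a b, Q (pure a b)) -> (forall x y, Q x -> Q y -> Q (x + y)) ->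
  (forall x, Q x -> Q (- x)) -> forall x, Q x.
Proof.
move=> Q0 Qp QD QN x; rewrite -[x]treprK; elim: (trepr x) => //.
- by move=> s Qs t Qt; rewrite tclass_add; apply: QD.
- by move=> s Qs; rewrite tclass_opp; apply: QN.
Qed.

Lemma pureDl a a' b : pure (a + a') b = pure a b + pure a' b.
Proof. by rewrite -tclass_add; apply/tclassP/tcongr_pureDl. Qed.
Lemma pureDr a b b' : pure a (b + b') = pure a b + pure a b'.
Proof. by rewrite -tclass_add; apply/tclassP/tcongr_pureDr. Qed.
Lemma pure_balanced a r b : pure (a * f r) b = pure a (g r * b).
Proof. exact/tclassP/tcongr_balanced. Qed.

Section Lift.
Variables (A : zmodType) (beta : S -> T -> A).

Fixpoint teval (t : tterm S T) : A :=
  match t with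
  | TenZero => 0
  | TenPure a b => beta a b
  | TenAdd s t => teval s + teval t
  | TenOpp s => - teval s
  end.

Record balanced : Prop := Balanced {
  balancedDl : forall a a' b, beta (a + a') b = beta a b + beta a' b;
  balancedDr : forall a b b', beta a (b + b') = beta a b + beta a b';
  balancedM : forall a r b, beta (a * f r) b = beta a (g r * b) }.

Definition tlift of balanced := fun x : tensor => teval (trepr x).

Hypothesis beta_balanced : balanced.

Lemma teval_congr s t : tcongr s t -> teval s = teval t.
Proof.
case: beta_balanced => Dl Dr M.
elim=> //=.
- by move=> u v w _ -> _ ->.
- by move=> u u' v v' _ -> _ ->.
- by move=> u u' _ ->.
- by move=> *; rewrite addrA.
- by move=> *; rewrite addrC.
- by move=> *; rewrite add0r.
- by move=> *; rewrite addNr.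
Qed.

Lemma tlift_class t : tlift beta_balanced (tclass t) = teval t.
Proof. exact/teval_congr/trepr_class. Qed.
Lemma tlift_pure a b : tlift beta_balanced (pure a b) = beta a b.
Proof. exact: tlift_class. Qed.
Lemma tlift_zmod_morphism : zmod_morphism (tlift beta_balanced).
Proof.
by move=> x y; rewrite -[x]treprK -[y]treprK -tclass_opp -tclass_add !tlift_class.
Qed.
HB.instance Definition _ := GRing.isZmodMorphism.Build tensor A
  (tlift beta_balanced) tlift_zmod_morphism.
End Lift.

(* The left R-module structure comes from left multiplication on S. *)
Lemma tscale_balanced (r : R) : balanced (fun a b => pure (f r * a) b).
Proof.
split=> *; first by rewrite mulrDr pureDl.
- by rewrite pureDr.
- by rewrite mulrA pure_balanced.
Qed.
Definition tscale (r : R) : tensor -> tensor := tlift (tscale_balanced r).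

HB.instance Definition _ r := GRing.isZmodMorphism.Build tensor tensor
  (tscale r) (tlift_zmod_morphism (tscale_balanced r)).

Lemma tscale_pure r a b : tscale r (pure a b) = pure (f r * a) b.
Proof. exact: tlift_pure. Qed.
Lemma tscaleA r s x : tscale r (tscale s x) = tscale (r * s) x.
Proof.
elim/tensor_ind: x => [|a b|x y IHx IHy|x IHx].
- by rewrite !raddf0.
- by rewrite !tscale_pure rmorphM mulrA.
- by rewrite !raddfD /= IHx IHy.
- by rewrite !raddfN /= IHx.
Qed.
Lemma tscale1 : left_id 1 tscale.
Proof.
move=> x; elim/tensor_ind: x => [|a b|x y IHx IHy|x IHx].
- by rewrite !raddf0.
- by rewrite !tscale_pure rmorph1 mul1r.
- by rewrite !raddfD /= IHx IHy.
- by rewrite !raddfN /= IHx.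
Qed.
Lemma tscaleDr : right_distributive tscale +%R.
Proof. by move=> r x y; rewrite raddfD. Qed.
Lemma tscaleDl x : {morph tscale^~ x : r s / r + s}.
Proof.
move=> r s; elim/tensor_ind: x => [|a b|x y IHx IHy|x IHx].
- by rewrite !raddf0 addr0.
- by rewrite !tscale_pure rmorphD mulrDl pureDl.
- by rewrite !raddfD /= IHx IHy addrACA.
- by rewrite !raddfN /= IHx opprD.
Qed.
HB.instance Definition _ := GRing.Zmodule_isLmodule.Build R tensor
  tscaleA tscale1 tscaleDr tscaleDl.
End Tensor.

Section Diff.
Variables (K : fieldType) (n : nat).
Local Notation U := (Ubar K n).
Local Notation hdiff := (@hdiff K n).
Local Notation htilde := (@htilde K n).
Local Notation const u := (TConst (u : U)).

(* The rings are K-algebras: the scalars of U commute with the generators.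
   Hence p x^j = x^j p[e_j] and p d_j = d_j p[-e_j] for every p in U. *)
Inductive x_rel (G : Type) (x : 'I_n -> G) : gterm U G -> gterm U G -> Prop :=
| x_scalar a j : x_rel x
    (const (Ubar_scalar n a) * TGen (x j)) (TGen (x j) * const (Ubar_scalar n a))
| x_weight i j : x_rel x
    (const (htilde i) * TGen (x j)) (TGen (x j) * const (htilde i + (i == j)%:R))
| x_quadratic (i j : 'I_n) : (i < j)%N -> x_rel x
    (TGen (x i) * TGen (x j))
    (const ((hdiff i j + 1) / hdiff i j) * (TGen (x j) * TGen (x i))).

Inductive d_rel (G : Type) (d : 'I_n -> G) : gterm U G -> gterm U G -> Prop :=
| d_scalar a j : d_rel d
    (const (Ubar_scalar n a) * TGen (d j)) (TGen (d j) * const (Ubar_scalar n a))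
| d_weight i j : d_rel d
    (const (htilde i) * TGen (d j)) (TGen (d j) * const (htilde i - (i == j)%:R))
| d_quadratic (i j : 'I_n) : (i < j)%N -> d_rel d
    (TGen (d i) * TGen (d j))
    (const ((hdiff i j - 1) / hdiff i j) * (TGen (d j) * TGen (d i))).

Definition Vring : Type := presented (x_rel id).
Definition Vstar : Type := presented (d_rel id).
HB.instance Definition _ := GRing.PzRing.on Vring.
HB.instance Definition _ := GRing.Lmodule.on Vring.
HB.instance Definition _ := GRing.PzRing.on Vstar.
HB.instance Definition _ := GRing.Lmodule.on Vstar.

Inductive gens : Type := Xgen of 'I_n | Dgen of 'I_n.

Inductive diff_rel (sigma : 'I_n -> U) : gterm U gens -> gterm U gens -> Prop :=
| diff_x s t : x_rel Xgen s t -> diff_rel sigma s t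
| diff_d s t : d_rel Dgen s t -> diff_rel sigma s t
| diff_lt (i j : 'I_n) : (i < j)%N -> diff_rel sigma
    (TGen (Xgen i) * TGen (Dgen j)) (TGen (Dgen j) * TGen (Xgen i))
| diff_gt (i j : 'I_n) : (j < i)%N -> diff_rel sigma
    (TGen (Xgen i) * TGen (Dgen j))
    (const ((hdiff i j * (hdiff i j - 2%:R)) / (hdiff i j - 1) ^+ 2)
       * (TGen (Dgen j) * TGen (Xgen i)))
| diff_eq i : diff_rel sigma
    (TGen (Xgen i) * TGen (Dgen i))
    (\big[@TAdd U gens/TConst 0]_(j < n)
        (const (1 / (1 - hdiff i j)) * (TGen (Dgen j) * TGen (Xgen j)))%T
     - const (sigma i)).

Definition Diff (sigma : 'I_n -> U) : Type := presented (diff_rel sigma).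
HB.instance Definition _ sigma := GRing.PzRing.on (Diff sigma).
HB.instance Definition _ sigma := GRing.Lmodule.on (Diff sigma).

Definition Vstar_Vring : Type :=
  tensor (gconst (d_rel id) : {rmorphism U -> Vstar})
         (gconst (x_rel id) : {rmorphism U -> Vring}).
HB.instance Definition _ := GRing.Lmodule.on Vstar_Vring.

Section PBW.
Variable sigma : 'I_n -> U.
Let cst : {rmorphism U -> Diff sigma} := gconst (diff_rel sigma).

Lemma Vring_to_Diff_rel (s t : gterm U 'I_n) : x_rel id s t ->
  geval cst (fun i => ggen (diff_rel sigma) (Xgen i)) s =
  geval cst (fun i => ggen (diff_rel sigma) (Xgen i)) t.
Proof.
move=> st; rewrite !geval_gmap; apply/gclassP/gcongr_rel/diff_x.
by case: st => *; constructor.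
Qed.

Lemma Vstar_to_Diff_rel (s t : gterm U 'I_n) : d_rel id s t ->
  geval cst (fun i => ggen (diff_rel sigma) (Dgen i)) s =
  geval cst (fun i => ggen (diff_rel sigma) (Dgen i)) t.
Proof.
move=> st; rewrite !geval_gmap; apply/gclassP/gcongr_rel/diff_d.
by case: st => *; constructor.
Qed.

Definition Vring_to_Diff : {rmorphism Vring -> Diff sigma} := glift Vring_to_Diff_rel.
Definition Vstar_to_Diff : {rmorphism Vstar -> Diff sigma} :=
  glift Vstar_to_Diff_rel.

Lemma mult_balanced :
  balanced (gconst (d_rel id) : {rmorphism U -> Vstar})
           (gconst (x_rel id) : {rmorphism U -> Vring})
           (fun a b => Vstar_to_Diff a * Vring_to_Diff b).
Proof.
split=> *; first by rewrite rmorphD mulrDl.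
- by rewrite rmorphD mulrDr.
- rewrite !rmorphM /= [glift Vstar_to_Diff_rel (gconst _ _)]glift_const.
  by rewrite [glift Vring_to_Diff_rel (gconst _ _)]glift_const mulrA.
Qed.

Definition PBW_mult : Vstar_Vring -> Diff sigma := tlift mult_balanced.

Lemma mult_zmod_morphism : zmod_morphism PBW_mult.
Proof. exact: tlift_zmod_morphism. Qed.
HB.instance Definition _ :=
  GRing.isZmodMorphism.Build Vstar_Vring (Diff sigma) PBW_mult mult_zmod_morphism.

Lemma mult_scalable : scalable PBW_mult.
Proof.
move=> u; apply: tensor_ind => [|a b|x y IHx IHy|x IHx].
- by rewrite scaler0 raddf0 scaler0.
- rewrite [u *: _]tscale_pure /PBW_mult !tlift_pure rmorphM /=.
  by rewrite [glift Vstar_to_Diff_rel (gconst _ _)]glift_const -mulrA.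
- by rewrite scalerDr !(raddfD PBW_mult) scalerDr; congr (_ + _).
- by rewrite scalerN !(raddfN PBW_mult) scalerN; congr (- _).
Qed.
HB.instance Definition _ :=
  GRing.isScalable.Build U Vstar_Vring (Diff sigma) *:%R PBW_mult mult_scalable.

(* The multiplication map a (x) b |-> ab of left U-modules is an isomorphism. *)
Definition PBW : Prop := bijective (PBW_mult : {linear Vstar_Vring -> Diff sigma}).
End PBW.
End Diff.

(* Main.v *)
(** The relations rewrite [x^i d_j] into combinations of [d_l x^m], so products
    of a polynomial in the [d]'s by one in the [x]'s span the ring, and the
    question is whether the overlaps [x x d] and [x d d] produce new relations.
    Reordering [x^i x^j d_j] in two ways, the terms with two [x]'s cancel and
    there remains [tau i j * x^i], where [tau i j = 0] is the difference equation
    for [sigma_j] and the shift of [h_i]; under PBW this forces [tau i j = 0].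
    Conversely, [tau = 0] also settles the overlaps [x d d]: the commutation of
    [x^i] past elements of [V^*] is then a ring morphism from [V^*] to matrices
    of size [n + 1] over [V^*], from which an action of the ring on
    [V^* (x) V] is built; evaluating it at [1 (x) 1] inverts multiplication. *)
From HB Require Import structures.
Require Import Defs.
From mathcomp Require Import all_boot all_order all_algebra.
From mathcomp Require Import fraction boolp.
From mathcomp Require Import mpoly ring.

Set Implicit Arguments.
Unset Strict Implicit.
Unset Printing Implicit Defensive.

Import GRing.Theory.
Local Open Scope ring_scope.

Lemma subrBB (A : zmodType) (a b c d : A) : a - b - (c - d) = a - c - (b - d).
Proof. by rewrite !opprB [d - c]addrC addrACA [d - b]addrC. Qed.

(** * Coefficient identities *)

Section UnitFractions.
Variables (R : comUnitRingType) (F : fieldType) (f : {rmorphism R -> F}).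
Hypothesis f_inj : injective f.
Implicit Types A B : R.

Let rmorphE := (rmorphXn f, rmorphM f, rmorphD f, rmorphN f, rmorph1 f, rmorph_nat f).

Lemma unit_im_neq0 A : A \is a GRing.unit -> f A != 0.
Proof. by move=> /(rmorph_unit f); rewrite unitfE. Qed.

Ltac neq0 := match goal with
  | |- is_true (_ && _) => apply/andP; split; neq0
  | H : is_true (~~ (?x == _)) |- is_true (~~ (?y == _)) =>
    solve [ exact: H
          | (have -> : y = x by ring); exact: H
          | (have -> : y = - x by ring); by rewrite oppr_eq0 ]
  end.

(** The injective morphism [f] carries the identity into a field, where [field] applies; the
    nonvanishing conditions it leaves are images of the unit hypotheses, up to [ring] and a sign. *)
Ltac unit_field :=
  intros; repeat match goal with H : is_true (_ \is a GRing.unit) |- _ =>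
    move: (unit_im_neq0 H); rewrite ?rmorphE => ?; revert H end; intros;
  apply: f_inj; rewrite ?(rmorphE, rmorphV f) ?unitrX //;
  rewrite ?rmorphE; field; neq0.

Lemma frac_a_xx A B : A \is a GRing.unit -> B - 1 \is a GRing.unit ->
   1 - (B - A) \is a GRing.unit -> 1 - B \is a GRing.unit ->
  1 / (1 - (B - A)) * (B / (B - 1)) + 1 / A * (1 / (1 - B)) =
  (A + 1) / A * (1 / (1 - (B - A))).
Proof. unit_field. Qed.

Lemma frac_a_xx0 A : A \is a GRing.unit -> 1 + A \is a GRing.unit ->
  1 / A = (A + 1) / A * (1 / (1 + A)).
Proof. unit_field. Qed.

Lemma frac_phi_c A : A - 1 \is a GRing.unit -> A - 2%:R \is a GRing.unit ->
  (A * (A - 2%:R)) / (A - 1) ^+ 2 * ((A - 1) / (A - 2%:R)) = A / (A - 1).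
Proof. unit_field. Qed.

Lemma frac_c_phi A : A - 1 \is a GRing.unit -> A \is a GRing.unit ->
  A / (A - 1) * (((A + 1) * (A - 1)) / A ^+ 2) = (A + 1) / A.
Proof. unit_field. Qed.

Lemma frac_e_phi A : A \is a GRing.unit -> A - 1 \is a GRing.unit ->
  (A - 1) / A * ((A * (A - 2%:R)) / (A - 1) ^+ 2) = (A - 2%:R) / (A - 1).
Proof. unit_field. Qed.

Lemma frac_a_dd A B : A - 1 \is a GRing.unit -> 1 - A \is a GRing.unit ->
    B \is a GRing.unit -> 1 - (A - B) \is a GRing.unit ->
  1 / (1 - A) * (1 / B) + 1 / (1 - (A - B)) * ((B - 1) / B) =
  (A - 2%:R) / (A - 1) * (1 / (1 - (A - B))).
Proof. unit_field. Qed.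

Lemma frac_a_dd0 A : A - 1 \is a GRing.unit -> 1 - A \is a GRing.unit ->
    2%:R - A \is a GRing.unit ->
  1 / (1 - A) = (A - 2%:R) / (A - 1) * (1 / (2%:R - A)).
Proof. unit_field. Qed.

Lemma frac_cK A : A \is a GRing.unit -> - A - 1 \is a GRing.unit ->
  (A + 1) / A * (- A / (- A - 1)) = 1.
Proof. unit_field. Qed.

Lemma frac_eK A : A \is a GRing.unit -> - A + 1 \is a GRing.unit ->
  (A - 1) / A * (- A / (- A + 1)) = 1.
Proof. unit_field. Qed.

Lemma frac_phi_e A : A \is a GRing.unit -> A + 1 \is a GRing.unit ->
  (A + 1) * (A - 1) / A ^+ 2 * (A / (A + 1)) = (A - 1) / A.
Proof. unit_field. Qed.

End UnitFractions.

Lemma tau_identity (R : comPzRingType) (A s s' t : R) :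
  (A + 1) * s - A * s' - 1 * t = s - t - - A * (s - s').
Proof. ring. Qed.

Lemma sigma_identity (R : comPzRingType) (B s s' t : R) :
  B * (s' - s) = s' - t -> - t + B * s = (B - 1) * s'.
Proof.
move=> e; have -> : t = s' - B * (s' - s) by rewrite e opprB addrC subrK.
ring.
Qed.

(** * Shifts and structure coefficients in [Ubar] *)

Section Coefficients.
Variables (K : fieldType) (n : nat).
Local Notation U := (Ubar K n).
Local Notation h := (@hdiff K n).
Implicit Types (i j k l : 'I_n) (u v : U).

Let Ubar_val_inj : injective (val : U -> _). Proof. exact: val_inj. Qed.

Lemma denominator_unit (s : {mpoly K[n]}) : denominator s -> Ubar_of s \is a GRing.unit.
Proof.
elim=> [|i j a t ij _ IH]; first by rewrite (rmorph1 (@Ubar_of K n)) unitr1.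
rewrite (rmorphM (@Ubar_of K n)) unitrM IH andbT (rmorphD (@Ubar_of K n)).
rewrite (rmorphB (@Ubar_of K n)) (rmorph_int (@Ubar_of K n)).
exact: hdiffD_unit.
Qed.

Lemma Ubar_frac u : exists p s, denominator s /\ u * Ubar_of s = Ubar_of p.
Proof.
have /asboolP[p [s [hs e]]] := valP u.
exists p, s; split=> //; apply: val_inj; rewrite (rmorphM (val : U -> _)) /= e divfK //.
by rewrite tofrac_eq0 denominator_neq0.
Qed.

Lemma hdiffxx i : h i i = 0. Proof. exact: subrr. Qed.

Lemma hdiff_unit i j : i != j -> h i j \is a GRing.unit.
Proof. by move=> ij; rewrite -[h i j]addr0 -[0](mulr0z 1) hdiffD_unit. Qed.

Lemma hdiffDn_unit i j m : i != j -> h i j + m%:R \is a GRing.unit.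
Proof. by move=> ij; rewrite pmulrn hdiffD_unit. Qed.

Lemma hdiffBn_unit i j m : i != j -> h i j - m%:R \is a GRing.unit.
Proof. by move=> ij; rewrite nmulrn hdiffD_unit. Qed.

Lemma subn_hdiff_unit i j m : i != j -> m%:R - h i j \is a GRing.unit.
Proof. by move=> ij; rewrite -opprB unitrN hdiffBn_unit. Qed.

Lemma sub1_hdiff_unit i j : 1 - h i j \is a GRing.unit.
Proof.
have [->|ij] := eqVneq i j; first by rewrite hdiffxx subr0 unitr1.
exact: (subn_hdiff_unit 1).
Qed.

Section Shift.
Variables (k : 'I_n) (b : int).
Local Notation s := (@Ubar_shift K n k b).

Lemma shift1 : s 1 = 1. Proof. exact: (rmorph1 s). Qed.
Lemma shift_nat m : s m%:R = m%:R. Proof. exact: (rmorph_nat s). Qed.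
Lemma shiftD u v : s (u + v) = s u + s v. Proof. exact: (rmorphD s). Qed.
Lemma shiftN u : s (- u) = - s u. Proof. exact: (rmorphN s). Qed.
Lemma shiftM u v : s (u * v) = s u * s v. Proof. exact: (rmorphM s). Qed.
Lemma shiftX u m : s (u ^+ m) = s u ^+ m. Proof. exact: (rmorphXn s). Qed.
Lemma shift_div u v : v \is a GRing.unit -> s (u / v) = s u / s v.
Proof. by move=> v1; exact: (rmorph_div s). Qed.

Definition shiftE := (shiftM, shiftX, shiftN, shiftD, shift1, shift_nat).
End Shift.

Lemma shift_hdiff (b : int) k i j :
  Ubar_shift k b (h i j) = h i j + (b *+ (i == k) - b *+ (j == k))%:~R.
Proof. by rewrite shiftD shiftN !Ubar_shift_h mulrzBr opprD addrACA. Qed.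

Lemma shift_hdiffl (b : int) i j : i != j -> Ubar_shift i b (h i j) = h i j + b%:~R.
Proof. by move=> ij; rewrite shift_hdiff eqxx eq_sym (negbTE ij) subr0. Qed.

Lemma shift_hdiffr (b : int) i j : i != j -> Ubar_shift j b (h i j) = h i j - b%:~R.
Proof. by move=> ij; rewrite shift_hdiff eqxx (negbTE ij) sub0r mulrNz. Qed.

Lemma shift_hdiff0 (b : int) k i j : k != i -> k != j -> Ubar_shift k b (h i j) = h i j.
Proof.
by move=> ki kj; rewrite shift_hdiff ![_ == k]eq_sym (negbTE ki) (negbTE kj) subr0 addr0.
Qed.

Lemma shift_up i j : i != j -> Ubar_shift i 1 (h i j) = h i j + 1.
Proof. exact: shift_hdiffl. Qed.
Lemma shift_down i j : i != j -> Ubar_shift i (-1) (h i j) = h i j - 1.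
Proof. by move=> ij; rewrite shift_hdiffl // mulrNz. Qed.
Lemma shift_upr i j : i != j -> Ubar_shift j 1 (h i j) = h i j - 1.
Proof. exact: shift_hdiffr. Qed.
Lemma shift_downr i j : i != j -> Ubar_shift j (-1) (h i j) = h i j + 1.
Proof. by move=> ij; rewrite shift_hdiffr // mulrNz opprK. Qed.

(** On polynomials this is [shift_polyK]; a fraction is multiplied by its denominator, a unit that
    the composite of the two shifts fixes. *)
Lemma Ubar_shiftK k (b : int) : cancel (Ubar_shift k b) (@Ubar_shift K n k (- b)).
Proof.
move=> u; have [p [s [/denominator_unit s1 e]]] := Ubar_frac u.
have K1 q : Ubar_shift k (- b) (Ubar_shift k b (Ubar_of q)) = Ubar_of q.
  by rewrite !shift_of shift_polyK.
by apply: (mulIr s1); rewrite e -[in RHS]K1 -e !shiftM K1.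
Qed.

(* The coefficients of the presentation, extended to all [i != j]:
   [x^i x^j = c_coef i j x^j x^i], [d_i d_j = e_coef i j d_j d_i],
   [x^i d_j = phi i j d_j x^i] and [x^i d_i = sum_j a_coef i j d_j x^j - sigma_i].
   The case split on [i < j] disappears in the products computed below. *)
Definition a_coef i j : U := 1 / (1 - h i j).
Definition phi i j : U :=
  if (i < j)%N then 1 else (h i j * (h i j - 2%:R)) / (h i j - 1) ^+ 2.
Definition c_coef i j : U :=
  if (i < j)%N then (h i j + 1) / h i j else h i j / (h i j - 1).
Definition e_coef i j : U :=
  if (i < j)%N then (h i j - 1) / h i j else h i j / (h i j + 1).

Let hdiff1_unit i j := @hdiffDn_unit i j 1.
Let hdiffB1_unit i j := @hdiffBn_unit i j 1.
Let unitE := (unitrX, hdiff_unit, hdiff1_unit, hdiffB1_unit, hdiffBn_unit, sub1_hdiff_unit).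

Lemma shift_a_coef0 (b : int) k i j : k != i -> k != j ->
  Ubar_shift k b (a_coef i j) = a_coef i j.
Proof.
move=> ki kj; rewrite /a_coef shift_div ?sub1_hdiff_unit //.
by rewrite !(shift_hdiff0 b ki kj, shiftE).
Qed.

Lemma shift_phi0 (b : int) k i j : k != i -> k != j -> i != j ->
  Ubar_shift k b (phi i j) = phi i j.
Proof.
move=> ki kj ij; rewrite /phi; case: ifP => _; first exact: shift1.
by rewrite shift_div ?unitE // !(shift_hdiff0 b ki kj, shiftE).
Qed.

Lemma shift_c_coef0 (b : int) k i j : k != i -> k != j -> i != j ->
  Ubar_shift k b (c_coef i j) = c_coef i j.
Proof.
move=> ki kj ij; rewrite /c_coef; case: ifP => _.
  by rewrite shift_div ?unitE // !(shift_hdiff0 b ki kj, shiftE).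
by rewrite shift_div ?unitE // !(shift_hdiff0 b ki kj, shiftE).
Qed.

Lemma shift_e_coef0 (b : int) k i j : k != i -> k != j -> i != j ->
  Ubar_shift k b (e_coef i j) = e_coef i j.
Proof.
move=> ki kj ij; rewrite /e_coef; case: ifP => _.
  by rewrite shift_div ?unitE // !(shift_hdiff0 b ki kj, shiftE).
by rewrite shift_div ?unitE // !(shift_hdiff0 b ki kj, shiftE).
Qed.

(** Four reordering factors follow: this one from [x^i d_j x^j] to [d_j x^j x^i], then from
    [x^i x^j d_j] to [x^j d_j x^i], from [x^i d_i d_j] to [d_j x^i d_i], and from [d_i x^i d_j] to
    [d_j d_i x^i]. *)
Lemma phi_shift_c i j : i != j ->
  phi i j * Ubar_shift j 1 (c_coef i j) = h i j / (h i j - 1).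
Proof.
move=> ij; rewrite /phi /c_coef; case: ifP => _.
  by rewrite shift_div ?unitE // !(shift_upr ij, shiftE) subrK mul1r.
rewrite shift_div ?unitE // !(shift_upr ij, shiftE).
have -> : h i j - 1 - 1 = h i j - 2%:R by rewrite -addrA -opprD.
by rewrite (frac_phi_c Ubar_val_inj) ?unitE.
Qed.

Lemma c_shift_phi i j : i != j ->
  c_coef i j * Ubar_shift j (-1) (phi i j) = (h i j + 1) / h i j.
Proof.
move=> ij; rewrite /phi /c_coef; case: ifP => _; first by rewrite shift1 mulr1.
rewrite shift_div ?unitE // !(shift_downr ij, shiftE) addrK.
have -> : h i j + 1 - 2%:R = h i j - 1 by rewrite mulr2n opprD addrA addrK.
by rewrite (frac_c_phi Ubar_val_inj) ?unitE.
Qed.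

Lemma shift_e_phi i j : i != j ->
  Ubar_shift i (-1) (e_coef i j) * phi i j = (h i j - 2%:R) / (h i j - 1).
Proof.
move=> ij; rewrite /phi /e_coef; case: ifP => _.
  rewrite shift_div ?unitE // !(shift_down ij, shiftE) mulr1.
  by congr (_ / _); rewrite -addrA -opprD.
rewrite shift_div ?unitE // !(shift_down ij, shiftE) subrK.
by rewrite (frac_e_phi Ubar_val_inj) ?unitE.
Qed.

Lemma shift_phi_e i j : i != j ->
  Ubar_shift i 1 (phi i j) * e_coef i j = (h i j - 1) / h i j.
Proof.
move=> ij; rewrite /phi /e_coef; case: ifP => _; first by rewrite shift1 mul1r.
rewrite shift_div ?unitE // !(shift_up ij, shiftE) addrK.
have -> : h i j + 1 - 2%:R = h i j - 1 by rewrite mulr2n opprD addrA addrK.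
by rewrite (frac_phi_e Ubar_val_inj) ?unitE.
Qed.

Lemma hdiffN i j : h j i = - h i j. Proof. by rewrite opprB. Qed.

Lemma hdiff_sub i j k : h i k - h i j = h j k.
Proof. by rewrite opprB addrC -addrA addKr. Qed.

Lemma c_coefK i j : i != j -> c_coef i j * c_coef j i = 1.
Proof.
wlog ij : i j / (i < j)%N => [W ne|ne].
  have [/W->//|ji] := ltnP i j; rewrite mulrC W // 1?eq_sym //.
  by rewrite ltn_neqAle ji andbT eq_sym.
rewrite /c_coef ij ltnNge (ltnW ij) /= (hdiffN i j) (frac_cK Ubar_val_inj) ?unitE //.
by rewrite -(hdiffN i j) unitE // eq_sym.
Qed.

Lemma e_coefK i j : i != j -> e_coef i j * e_coef j i = 1.
Proof.
wlog ij : i j / (i < j)%N => [W ne|ne].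
  have [/W->//|ji] := ltnP i j; rewrite mulrC W // 1?eq_sym //.
  by rewrite ltn_neqAle ji andbT eq_sym.
rewrite /e_coef ij ltnNge (ltnW ij) /= (hdiffN i j) (frac_eK Ubar_val_inj) ?unitE //.
by rewrite -(hdiffN i j) unitE // eq_sym.
Qed.

Lemma shift_a_coefV i j : i != j ->
  Ubar_shift i (-1) (a_coef j i) = 1 / h i j.
Proof.
move=> ij; have ji : j != i by rewrite eq_sym.
rewrite /a_coef shift_div ?unitE // !(shift_downr ji, shiftE) [_ + 1]addrC.
by rewrite opprD addrA subrr sub0r -hdiffN.
Qed.

Lemma shift_a_coef_up k l : l != k ->
  Ubar_shift k 1 (a_coef k l) = 1 / h l k.
Proof.
move=> lk; have kl : k != l by rewrite eq_sym.
rewrite /a_coef shift_div ?unitE // !(shift_up kl, shiftE) [_ + 1]addrC.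
by rewrite opprD addrA subrr sub0r -hdiffN.
Qed.

(** Equality of the coefficients of [d_p x^p x^i] in the two reorderings of [x^i x^j d_j];
    [a_coef_xx0] is the coefficient for [p = i]. *)
Lemma a_coef_xx i j p : i != j -> i != p ->
  Ubar_shift i (-1) (a_coef j p) * (h i p / (h i p - 1))
    + Ubar_shift i (-1) (a_coef j i) * a_coef i p
  = (h i j + 1) / h i j * a_coef j p.
Proof.
move=> ij ip; rewrite shift_a_coef0 // shift_a_coefV //.
rewrite /a_coef -(hdiff_sub i j p) (frac_a_xx Ubar_val_inj) ?unitE //.
by rewrite hdiff_sub unitE.
Qed.

Lemma a_coef_xx0 i j : i != j ->
  Ubar_shift i (-1) (a_coef j i) = (h i j + 1) / h i j * a_coef j i.
Proof.
move=> ij; rewrite shift_a_coefV // /a_coef (hdiffN i j) opprK.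
by rewrite -(frac_a_xx0 Ubar_val_inj) // ?[1 + _]addrC ?unitE.
Qed.

(** Equality of the coefficients of [d_k d_l x^l] in the two reorderings of [x^j d_j d_k];
    [a_coef_dd0] is the coefficient for [l = k]. *)
Lemma a_coef_dd j k l : j != k -> l != k ->
  a_coef j k * Ubar_shift k 1 (a_coef k l) + a_coef j l * ((h l k - 1) / h l k)
  = (h j k - 2%:R) / (h j k - 1) * Ubar_shift k 1 (a_coef j l).
Proof.
move=> jk lk; rewrite shift_a_coef_up // shift_a_coef0 1?eq_sym //.
have e : h j l = h j k - h l k by rewrite /hdiff opprB addrA subrK.
by rewrite /a_coef e (frac_a_dd Ubar_val_inj) ?unitE // -e unitE.
Qed.

Lemma a_coef_dd0 j k : j != k ->
  a_coef j k = (h j k - 2%:R) / (h j k - 1) * Ubar_shift k 1 (a_coef j k).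
Proof.
move=> jk; rewrite /a_coef shift_div ?unitE // !(shift_upr jk, shiftE).
have -> : 1 - (h j k - 1) = 2%:R - h j k by rewrite opprB addrA.
by rewrite -(frac_a_dd0 Ubar_val_inj) ?unitE // subn_hdiff_unit.
Qed.

Variable sigma : 'I_n -> U.

(* The coefficient of [x^i] in [(x^i x^j - c_coef i j x^j x^i) d_j]. *)
Definition tau i j : U :=
  (h i j + 1) / h i j * sigma j - Ubar_shift i (-1) (sigma j) - 1 / h i j * sigma i.

(** Multiplication by the unit [h i j] clears the denominators of [tau i j] and leaves exactly the
    difference of the two sides. *)
Lemma tau_eq0 i j : i != j ->
  tau i j = 0 <-> h j i * Delta i (sigma j) = sigma j - sigma i.
Proof.
move=> ij; have hu := hdiff_unit ij.
have e : h i j * tau i j = sigma j - sigma i - h j i * Delta i (sigma j).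
  have e1 : h i j * ((h i j + 1) / h i j) = h i j + 1 by rewrite mulrC divrK.
  have e2 : h i j * (1 / h i j) = 1 by rewrite mulrC divrK.
  rewrite /tau 2!mulrBr 2!(mulrA (h i j) (_ / _)) e1 e2 (hdiffN i j) /Delta.
  exact: tau_identity.
split=> [t0|q]; first by move: e; rewrite t0 mulr0 => /esym/eqP; rewrite subr_eq0 => /eqP.
by apply: (mulrI hu); rewrite e q subrr mulr0.
Qed.

(** The condition that the overlap [x^j d_j d_k] imposes on the coefficient of [d_k]. It is the
    difference equation after the shift of [h_k] by 1, divided by the unit [h j k - 1], so this
    overlap adds nothing new. *)
Lemma sigma_dd j k : j != k -> h j k * Delta k (sigma j) = sigma j - sigma k ->
  a_coef j k * Ubar_shift k 1 (sigma k) + sigma j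
  = (h j k - 2%:R) / (h j k - 1) * Ubar_shift k 1 (sigma j).
Proof.
move=> jk /(congr1 (Ubar_shift k 1)); rewrite /Delta shiftM shift_upr // !shiftE.
rewrite (Ubar_shiftK k (-1)) => e; have hu : h j k - 1 \is a GRing.unit by rewrite unitE.
apply: (mulrI hu); rewrite mulrDr [RHS]mulrA [_ * (_ / _)]mulrC divrK //.
have -> : (h j k - 1) * (a_coef j k * Ubar_shift k 1 (sigma k)) = - Ubar_shift k 1 (sigma k).
  rewrite mulrA -opprB mulNr /a_coef [_ * (1 / _)]mulrC divrK ?unitE //.
  by rewrite mulN1r.
have <- : h j k - 1 - 1 = h j k - 2%:R by rewrite -addrA -opprD.
exact: sigma_identity.
Qed.

End Coefficients.

(** * Weight relations for arbitrary coefficients *)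

Section Weights.
Variables (K : fieldType) (n : nat).
Local Notation U := (Ubar K n).
Implicit Types (k l : 'I_n) (u v : U).

(** The elements [u] with this property are closed under sums, products and inverses, so the
    generators suffice. With [x = 1] this says that two morphisms agreeing on scalars and on the
    [htilde i] are equal. *)
Lemma Ubar_intertwine (A : pzRingType) (f g : {rmorphism U -> A}) (x : A) :
  (forall c, f (Ubar_scalar n c) * x = x * g (Ubar_scalar n c)) ->
  (forall i, f (htilde K i) * x = x * g (htilde K i)) ->
  forall u, f u * x = x * g u.
Proof.
move=> fc fh.
have fM u v : f u * x = x * g u -> f v * x = x * g v -> f (u * v) * x = x * g (u * v).
  by move=> eu ev; rewrite (rmorphM f) (rmorphM g) -mulrA ev mulrA eu mulrA.
have fp (p : {mpoly K[n]}) : f (Ubar_of p) * x = x * g (Ubar_of p).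
  rewrite (mpolyE p) (rmorph_sum (@Ubar_of K n)) (rmorph_sum f) (rmorph_sum g).
  rewrite mulr_suml mulr_sumr; apply: eq_bigr => m _.
  rewrite -mul_mpolyC (rmorphM (@Ubar_of K n)); apply: (fM); first exact: fc.
  rewrite mpolyXE_id (rmorph_prod (@Ubar_of K n)).
  apply: (big_rec (fun u => f u * x = x * g u)) => [|i u _ IH].
    by rewrite !rmorph1 mul1r mulr1.
  apply: (fM) => //; rewrite (rmorphXn (@Ubar_of K n)).
  elim: (m i) => [|d IHd]; first by rewrite !expr0 !rmorph1 mul1r mulr1.
  by rewrite exprS; apply: (fM) => //; apply: fh.
move=> u; have [p [s [/denominator_unit s1 e]]] := Ubar_frac u.
have -> : u = Ubar_of p / Ubar_of s by rewrite -e mulrK.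
apply: (fM) => //.
(* For the inverse of [s], the identity [f s * x = x * g s] is multiplied by [f s^-1] on the left
   and by [g s^-1] on the right. *)
have e1 : f (Ubar_of s)^-1 * f (Ubar_of s) = 1 by rewrite -(rmorphM f) mulVr // rmorph1.
have e2 : g (Ubar_of s) * g (Ubar_of s)^-1 = 1 by rewrite -(rmorphM g) mulrV // rmorph1.
by rewrite -[LHS]mulr1 -e2 -mulrA [X in _ * X]mulrA -fp !mulrA e1 mul1r.
Qed.

Lemma Ubar_shiftC k l (b c : int) u :
  Ubar_shift k b (Ubar_shift l c u) = Ubar_shift l c (Ubar_shift k b u).
Proof.
have := @Ubar_intertwine _ (Ubar_shift k b \o Ubar_shift l c)
  (Ubar_shift l c \o Ubar_shift k b) 1.
move=> /(_ _ _ u) /=; rewrite mulr1 mul1r; apply=> [a|i]; rewrite mulr1 mul1r.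
  by rewrite !(shift_of, shift_polyC).
by rewrite !(shiftD, Ubar_shift_h) !rmorph_int addrAC.
Qed.

End Weights.

(** * The overlap [x x d] *)

Section HSystem.
Variables (K : fieldType) (n : nat).
Local Notation U := (Ubar K n).
Local Notation h := (@hdiff K n).
Variables (sigma : 'I_n -> U) (M : lmodType U) (X D : 'I_n -> {additive M -> M}).

(** Only the weight relations and the mixed relations are imposed. Both left multiplication on
    [Diff sigma] and the operators on the tensor product fit, the latter before the [x x] relations
    are known for them. *)
Record hsystem : Prop := HSystem {
  hsystem_XZ : forall i u m, X i (u *: m) = Ubar_shift i (-1) u *: X i m;
  hsystem_DZ : forall i u m, D i (u *: m) = Ubar_shift i 1 u *: D i m;
  hsystem_ne : forall i j m, i != j -> X i (D j m) = phi K i j *: D j (X i m);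
  hsystem_eq : forall i m,
    X i (D i m) = \sum_j a_coef K i j *: D j (X j m) - sigma i *: m }.

(** Imposed at a single vector, so that it can serve as an induction hypothesis in [act_xx]. *)
Definition xx_commute m := forall i j, i != j -> X i (X j m) = c_coef K i j *: X j (X i m).

Hypothesis XD : hsystem.

(** The mixed relations expand both terms along the vectors [D l (X l (X i m))]. Their coefficients
    cancel by [a_coef_xx] and [a_coef_xx0], and the [sigma] terms add up to [tau i j]. *)
Lemma xx_defect m i j : xx_commute m -> i != j ->
  X i (X j (D j m)) - c_coef K i j *: X j (X i (D j m)) = tau sigma i j *: X i m.
Proof.
case: XD => XZ DZ XDne XDeq xx ij.
rewrite XDeq raddfB raddf_sum /= XZ XDne // XZ XDeq scalerA c_shift_phi //.
set y := X i m; set Y := fun l => D l (X l y).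
have Yl l : i != l -> X i (D l (X l m)) = (h i l / (h i l - 1)) *: Y l.
  by move=> il; rewrite XDne // xx // DZ scalerA phi_shift_c.
have a1 : a_coef K i i = 1 by rewrite /a_coef hdiffxx subr0 divr1.
pose S k := \sum_(l < n | l != i) a_coef K k l *: Y l.
have SE k : \sum_l a_coef K k l *: Y l = a_coef K k i *: Y i + S k by rewrite (bigD1 i).
have E1 : \sum_l X i (a_coef K j l *: D l (X l m)) =
    Ubar_shift i (-1) (a_coef K j i) *: (Y i - sigma i *: y) + (h i j + 1) / h i j *: S j.
  under eq_bigr do rewrite XZ.
  (* The identity [a_coef_xx] is solved for its first summand; the [S i] subtracted here is the one
     produced by expanding the term [l = i]. *)
  have E2 : \sum_(l < n | l != i) Ubar_shift i (-1) (a_coef K j l) *: X i (D l (X l m))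
      = (h i j + 1) / h i j *: S j - Ubar_shift i (-1) (a_coef K j i) *: S i.
    rewrite /S !scaler_sumr -sumrB; apply: eq_bigr => l li.
    have il : i != l by rewrite eq_sym.
    rewrite (Yl _ il) !scalerA -scalerBl; congr (_ *: _).
    by rewrite -(a_coef_xx K ij il) addrK.
  rewrite (bigD1 i) //= XDeq -/y SE a1 scale1r E2 [Y i + S i]addrC -addrA scalerDr.
  by rewrite addrC addrA subrK addrC.
rewrite E1 SE -/y a_coef_xx0 // /tau -(a_coef_xx0 K ij) (shift_a_coefV K ij).
rewrite !scalerBr !scalerDr !scalerBl !scalerA -(a_coef_xx0 K ij) (shift_a_coefV K ij).
set p := _ *: Y i; set q := _ *: S j.
move: p q (_ *: y) (_ *: y) (_ *: y) => p q r s t.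
rewrite opprB [p - t + q]addrAC [LHS]addrC -(addrA (p + q)) (addrA (r - _)).
by rewrite subrK addrA addrAC.
Qed.
End HSystem.

(** * Presented rings and their actions *)

Section PresentedTheory.
Variables (R : pzRingType) (G : Type) (rels : gterm R G -> gterm R G -> Prop).
Local Notation T := (presented rels).

(** Induction on a term representing [x], generalised over the element it multiplies from the left;
    a product of terms then becomes two successive left multiplications. *)
Lemma presented_lind (P : T -> Prop) :
  P 1 -> (forall x y, P x -> P y -> P (x + y)) -> (forall x, P x -> P (- x)) ->
  (forall a x, P x -> P (gconst rels a * x)) ->
  (forall g x, P x -> P (ggen rels g * x)) -> forall x, P x.
Proof.
move=> P1 PD PN Pc Pg x; rewrite -[x]greprK -[gclass _ _]mulr1.
move: (grepr x) (1 : T) P1; elim=> [a|g|s IHs t IHt|s IHs|s IHs t IHt] y Py.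
- exact: Pc.
- exact: Pg.
- by rewrite gclass_add mulrDl; apply: PD; [apply: IHs | apply: IHt].
- by rewrite gclass_opp mulNr; apply/PN/IHs.
- by rewrite gclass_mul -mulrA; apply/IHs/IHt.
Qed.

Variables (M : zmodType) (c : R -> M -> M) (g : G -> M -> M).

(** The analogue of [geval] with composition of maps as product, so that relations can be verified
    vector by vector. *)
Fixpoint gact (t : gterm R G) (m : M) : M :=
  match t with
  | TConst a => c a m
  | TGen x => g x m
  | TAdd s t => gact s m + gact t m
  | TOpp s => - gact s m
  | TMul s t => gact s (gact t m)
  end.

Hypothesis cB : forall a, zmod_morphism (c a).
Hypothesis gB : forall x, zmod_morphism (g x).
Hypothesis c1 : forall m, c 1 m = m.
Hypothesis cD : forall a b m, c (a + b) m = c a m + c b m.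
Hypothesis cM : forall a b m, c (a * b) m = c a (c b m).
Hypothesis g_rel : forall s t, rels s t -> forall m, gact s m = gact t m.

Lemma gactB t : zmod_morphism (gact t).
Proof.
elim: t => //= [s IHs t IHt|s IHs|s IHs t IHt] x y.
- by rewrite IHs IHt opprD addrACA.
- by rewrite IHs opprD.
- by rewrite IHt IHs.
Qed.

Lemma gact_congr s t m : gcongr rels s t -> gact s m = gact t m.
Proof.
have c0 x : c 0 x = 0 by apply: (addrI (c 0 x)); rewrite -cD !addr0.
have gactD s' x y : gact s' (x + y) = gact s' x + gact s' y.
  have gact0 : gact s' 0 = 0 by rewrite -[X in gact s' X](subrr (0 : M)) gactB subrr.
  have gactN z : gact s' (- z) = - gact s' z by rewrite -[- z]sub0r gactB gact0 sub0r.
  by rewrite -{1}[y]opprK gactB gactN opprK.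
move=> st; elim: st m => //=.
- by move=> u v w _ e1 _ e2 x; rewrite e1.
- by move=> u u' v v' _ e1 _ e2 x; rewrite e1 e2.
- by move=> u u' _ e x; rewrite e.
- by move=> u u' v v' _ e1 _ e2 x; rewrite e2 e1.
- by move=> *; rewrite addrA.
- by move=> *; rewrite addrC.
- by move=> *; rewrite c0 add0r.
- by move=> *; rewrite c0 addNr.
- by move=> s0 x; rewrite c1.
Qed.

Definition pact (y : T) : M -> M := gact (grepr y).

Lemma pact_class t m : pact (gclass rels t) m = gact t m.
Proof. exact/gact_congr/grepr_class. Qed.
Lemma pactD y z m : pact (y + z) m = pact y m + pact z m.
Proof. by rewrite -[y]greprK -[z]greprK -gclass_add !pact_class. Qed.
Lemma pactN y m : pact (- y) m = - pact y m.
Proof. by rewrite -[y]greprK -gclass_opp !pact_class. Qed.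
Lemma pactM y z m : pact (y * z) m = pact y (pact z m).
Proof. by rewrite -[y]greprK -[z]greprK -gclass_mul !pact_class. Qed.
Lemma pact_const a m : pact (gconst rels a) m = c a m. Proof. exact: pact_class. Qed.
Lemma pact_gen x m : pact (ggen rels x) m = g x m. Proof. exact: pact_class. Qed.
Lemma pact1 m : pact 1 m = m.
Proof. by rewrite -[RHS]c1 -pact_const rmorph1. Qed.
End PresentedTheory.

(** * Commutation rules, for any relations containing those of the [x] or of the [d] *)

Section XRel.
Variables (K : fieldType) (n : nat) (G : Type).
Variable rels : gterm (Ubar K n) G -> gterm (Ubar K n) G -> Prop.
Variable x : 'I_n -> G.
Hypothesis x_sub : forall s t, x_rel x s t -> rels s t.
Local Notation U := (Ubar K n).

Lemma x_const i u : ggen rels (x i) * gconst rels u =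
  gconst rels (Ubar_shift i (-1) u) * ggen rels (x i).
Proof.
rewrite (@Ubar_intertwine _ _ _ (gconst rels) (gconst rels \o Ubar_shift i 1)) /=
  ?(Ubar_shiftK i (-1)) //.
- move=> c; rewrite /= shift_of shift_polyC -!gclass_mul.
  by apply/gclassP/gcongr_rel/x_sub/x_scalar.
move=> j; rewrite /= Ubar_shift_h.
have -> : (1 *+ (j == i))%:~R = (j == i)%:R :> U by case: eqP.
by rewrite -!gclass_mul; apply/gclassP/gcongr_rel/x_sub/x_weight.
Qed.

Lemma x_swap i j : i != j -> ggen rels (x i) * ggen rels (x j) =
  gconst rels (c_coef K i j) * (ggen rels (x j) * ggen rels (x i)).
Proof.
have lt (k l : 'I_n) : (k < l)%N -> ggen rels (x k) * ggen rels (x l) =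
    gconst rels (c_coef K k l) * (ggen rels (x l) * ggen rels (x k)).
  move=> kl; rewrite /c_coef kl -gclass_mul.
  have /gclassP-> := gcongr_rel (x_sub (x_quadratic K x kl)).
  by rewrite !gclass_mul.
move=> ij; have := ij; rewrite neq_ltn => /orP[/lt//|/lt->].
by rewrite mulrA -(rmorphM (gconst rels)) c_coefK // rmorph1 mul1r.
Qed.
End XRel.

Section DRel.
Variables (K : fieldType) (n : nat) (G : Type).
Variable rels : gterm (Ubar K n) G -> gterm (Ubar K n) G -> Prop.
Variable d : 'I_n -> G.
Hypothesis d_sub : forall s t, d_rel d s t -> rels s t.
Local Notation U := (Ubar K n).

Lemma d_const i u : ggen rels (d i) * gconst rels u =
  gconst rels (Ubar_shift i 1 u) * ggen rels (d i).
Proof.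
rewrite (@Ubar_intertwine _ _ _ (gconst rels) (gconst rels \o Ubar_shift i (-1))) /=
  ?(Ubar_shiftK i 1) //.
- move=> c; rewrite /= shift_of shift_polyC -!gclass_mul.
  by apply/gclassP/gcongr_rel/d_sub/d_scalar.
move=> j; rewrite /= Ubar_shift_h.
have -> : ((-1) *+ (j == i))%:~R = - (j == i)%:R :> U by case: eqP; rewrite ?oppr0.
by rewrite -!gclass_mul; apply/gclassP/gcongr_rel/d_sub/d_weight.
Qed.

Lemma d_swap i j : i != j -> ggen rels (d i) * ggen rels (d j) =
  gconst rels (e_coef K i j) * (ggen rels (d j) * ggen rels (d i)).
Proof.
have lt (k l : 'I_n) : (k < l)%N -> ggen rels (d k) * ggen rels (d l) =
    gconst rels (e_coef K k l) * (ggen rels (d l) * ggen rels (d k)).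
  move=> kl; rewrite /e_coef kl -gclass_mul.
  have /gclassP-> := gcongr_rel (d_sub (d_quadratic K d kl)).
  by rewrite !gclass_mul.
move=> ij; have := ij; rewrite neq_ltn => /orP[/lt//|/lt->].
by rewrite mulrA -(rmorphM (gconst rels)) e_coefK // rmorph1 mul1r.
Qed.
End DRel.

(** * The overlap relation in the ring itself *)

Section DiffSystem.
Variables (K : fieldType) (n : nat) (sigma : 'I_n -> Ubar K n).
Local Notation U := (Ubar K n).
Local Notation A := (Diff sigma).
Local Notation r := (diff_rel sigma).
Let x_ i : A := ggen r (Xgen i).
Let d_ i : A := ggen r (Dgen i).

Lemma Diff_ne i j : i != j -> x_ i * d_ j = gconst r (phi K i j) * (d_ j * x_ i).
Proof.
rewrite neq_ltn /phi => /orP[] ij.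
  by rewrite ij rmorph1 mul1r -!gclass_mul; apply/gclassP/gcongr_rel/diff_lt.
rewrite ltnNge (ltnW ij) /= -gclass_mul.
have /gclassP-> := gcongr_rel (diff_gt sigma ij).
by rewrite !gclass_mul.
Qed.

Lemma Diff_eq i :
  x_ i * d_ i = \sum_j gconst r (a_coef K i j) * (d_ j * x_ j) - gconst r (sigma i).
Proof.
rewrite -gclass_mul; have /gclassP -> := gcongr_rel (diff_eq sigma i).
rewrite gclass_add gclass_opp.
rewrite (big_morph (gclass r) (@gclass_add _ _ r) (erefl : gclass r (TConst 0) = 0)).
by congr (_ - _); apply: eq_bigr => j _; rewrite !gclass_mul.
Qed.

Definition Diff_X i : {additive A -> A} := x_ i \*o idfun.
Definition Diff_D i : {additive A -> A} := d_ i \*o idfun.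

Lemma scaleDiffE (u : U) (y : A) : u *: y = gconst r u * y. Proof. by []. Qed.

Lemma Diff_hsystem : hsystem sigma Diff_X Diff_D.
Proof.
have dx := @diff_x K n sigma; have dd := @diff_d K n sigma.
split=> [i u m|i u m|i j m ij|i m]; rewrite ?scaleDiffE /=.
- by rewrite mulrA (x_const dx) mulrA.
- by rewrite mulrA (d_const dd) mulrA.
- by rewrite mulrA -/(x_ i) -/(d_ j) Diff_ne // !mulrA.
rewrite mulrA -/(x_ i) -/(d_ i) Diff_eq mulrBl mulr_suml; congr (_ - _).
by apply: eq_bigr => j _; rewrite scaleDiffE !mulrA.
Qed.

(** In the ring the [x] satisfy their quadratic relations, so the left side of [xx_defect] at the
    vector 1 vanishes. *)
Lemma Diff_tau i j : i != j -> tau sigma i j *: x_ i = 0.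
Proof.
move=> ij; have dx := @diff_x K n sigma.
have swap k l (y : A) : k != l ->
    x_ k * (x_ l * y) = gconst r (c_coef K k l) * (x_ l * (x_ k * y)).
  by move=> kl; rewrite !mulrA (x_swap dx kl) !mulrA.
have := @xx_defect _ _ _ _ _ _ Diff_hsystem 1 i j.
rewrite /= [x_ i * 1]mulr1 => <- //; first by rewrite scaleDiffE -swap // subrr.
by move=> k l kl; exact: swap.
Qed.
End DiffSystem.

Section DiagMorphism.
Variables (R S : pzRingType) (m : nat) (g : 'I_m -> {rmorphism R -> S}).

(** Each row has its own morphism, since a coefficient is shifted differently when it crosses
    different generators. *)
Definition diag_morph (u : R) : 'M[S]_m := \matrix_(i, j) (g i u *+ (i == j)).

Lemma diag_morph_zmod : zmod_morphism diag_morph.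
Proof. by move=> u v; apply/matrixP=> i j; rewrite !mxE rmorphB mulrnBl. Qed.

Lemma diag_morph_mul u p (A : 'M_(m, p)) i j : (diag_morph u *m A) i j = g i u * A i j.
Proof.
rewrite mxE (bigD1 i) //= big1 ?addr0 ?mxE ?eqxx // => k ki.
by rewrite mxE eq_sym (negbTE ki) mul0r.
Qed.

Lemma mul_diag_morph u p (A : 'M_(p, m)) i j : (A *m diag_morph u) i j = A i j * g j u.
Proof.
rewrite mxE (bigD1 j) //= big1 ?addr0 ?mxE ?eqxx // => k kj.
by rewrite mxE (negbTE kj) mulr0.
Qed.

Lemma diag_morph_monoid : monoid_morphism diag_morph.
Proof.
split=> [|u v]; first by apply/matrixP=> i j; rewrite !mxE rmorph1.
by apply/matrixP=> i j; rewrite diag_morph_mul !mxE rmorphM mulrnAr.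
Qed.

HB.instance Definition _ := GRing.isZmodMorphism.Build R 'M[S]_m diag_morph diag_morph_zmod.
HB.instance Definition _ := GRing.isMonoidMorphism.Build R 'M[S]_m diag_morph diag_morph_monoid.
End DiagMorphism.

(** * Necessity *)

Section LinearPart.
Variables (K : fieldType) (n : nat).
Local Notation U := (Ubar K n).
Local Notation V := (Vring K n).
Local Notation Vs := (Vstar K n).

Lemma aug_rel s t : @d_rel K n _ id s t ->
  geval (idfun : {rmorphism U -> U}) (fun=> 0) s =
  geval (idfun : {rmorphism U -> U}) (fun=> 0) t.
Proof. by case=> [*|*|*] /=; rewrite ?(mulr0, mul0r). Qed.

Definition aug : {rmorphism Vs -> U} := glift aug_rel.

Variable i : 'I_n.

(* [V] modulo the products of two generators, followed by projection on [x^i]. *)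
Definition lin_const : {rmorphism U -> 'M[U]_2} :=
  diag_morph (fun k : 'I_2 => if k == 0 then idfun : {rmorphism U -> U}
                              else Ubar_shift i (-1) : {rmorphism U -> U}).
Definition lin_gen (j : 'I_n) : 'M[U]_2 := delta_mx 0 1 *+ (i == j).

(** Products of two images vanish, which settles the quadratic relations; the shift in the second
    diagonal entry matches the weight of [x^i]. *)
Lemma lin_rel s t : @x_rel K n _ id s t ->
  geval lin_const lin_gen s = geval lin_const lin_gen t.
Proof.
have lin0 j k : lin_gen j * lin_gen k = 0.
  by rewrite /lin_gen mulrnAl mulrnAr -mulmxE mul_delta_mx_0 // !mul0rn.
have lin_shift u v j : u = Ubar_shift j (-1) v ->
    lin_const u * lin_gen j = lin_gen j * lin_const v.
  move=> ->; rewrite /lin_gen; case: eqP => [<-|_]; last by rewrite mulr0 mul0r.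
  apply/matrixP=> k l; rewrite mulr1n diag_morph_mul mul_diag_morph !mxE.
  case: (k == 0); last by rewrite mulr0 mul0r.
  by case: (l =P 1) => [->|_] /=; rewrite ?(mulr0, mul0r, mulr1, mul1r).
case=> [a j|k j|j k jk] /=; last by rewrite !lin0 mulr0.
  by apply: lin_shift; rewrite shift_of shift_polyC.
apply: lin_shift; rewrite shiftD shift_nat Ubar_shift_h.
by case: eqP => _; rewrite ?addr0 // mulrNz subrK.
Qed.

Definition lin : {rmorphism V -> 'M[U]_2} := glift lin_rel.

Lemma lin_part_balanced :
  balanced (gconst (d_rel id) : {rmorphism U -> Vs}) (gconst (x_rel id) : {rmorphism U -> V})
    (fun a b => aug a * lin b 0 1).
Proof.
split=> [a a' b|a b b'|a u b]; rewrite ?rmorphD ?mulrDl ?mxE ?mulrDr //.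
rewrite !rmorphM /= [glift aug_rel (gconst _ _)]glift_const.
by rewrite [glift lin_rel (gconst _ _)]glift_const diag_morph_mul mulrA.
Qed.

(** The functional sending [a (x) b] to [aug a * lin b 0 1] takes the value [u] on this element.
    Thus [1 (x) x^i] is seen to be torsion-free without constructing a basis. *)
Lemma scale_pure1_gen_eq0 (u : U) :
  u *: (pure _ _ 1 (ggen (x_rel id) i) : Vstar_Vring K n) = 0 -> u = 0.
Proof.
move=> /(congr1 (tlift lin_part_balanced)); rewrite [_ *: _]tscale_pure tlift_pure mulr1.
by rewrite /= glift_const glift_gen raddf0 /lin_gen eqxx mxE mulr1.
Qed.
End LinearPart.

(** Injectivity of multiplication lifts the relation of [Diff_tau] to the tensor product, where
    [1 (x) x^i] is torsion-free. *)
Lemma PBW_tau0 (K : fieldType) (n : nat) (sigma : 'I_n -> Ubar K n) i j :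
  PBW sigma -> i != j -> tau sigma i j = 0.
Proof.
move=> [G GK _] ij; apply: (@scale_pure1_gen_eq0 _ _ i).
apply: (can_inj GK); rewrite linear0 linearZ /= /PBW_mult tlift_pure rmorph1 mul1r.
have -> : Vring_to_Diff sigma (ggen (x_rel id) i) = ggen (diff_rel sigma) (Xgen i).
  exact: glift_gen.
exact: Diff_tau.
Qed.

Lemma tensor_ext (R S T : pzRingType) (f : {rmorphism R -> S}) (g : {rmorphism R -> T})
    (A : zmodType) (p q : tensor f g -> A) :
  zmod_morphism p -> zmod_morphism q ->
  (forall a b, p (pure f g a b) = q (pure f g a b)) -> p =1 q.
Proof.
move=> pB qB pq; pose r m := p m - q m.
have rB : zmod_morphism r by move=> x y; rewrite /r pB qB subrBB.
have r0 : r 0 = 0 by rewrite -[X in r X](subrr 0) rB subrr.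
have rN x : r (- x) = - r x by rewrite -[- x]sub0r rB r0 sub0r.
suff r_eq0 m : r m = 0 by move=> m; apply/eqP; rewrite -subr_eq0; apply/eqP/r_eq0.
elim/tensor_ind: m => [|a b|x y rx ry|x rx] //.
- by rewrite /r pq subrr.
- by rewrite -[y]opprK rB rN ry rx !oppr0 addr0.
- by rewrite rN rx oppr0.
Qed.

(** * Sufficiency *)

Section TwistedAction.
Variables (K : fieldType) (n : nat) (sigma : 'I_n -> Ubar K n).
Local Notation U := (Ubar K n).
Local Notation h := (@hdiff K n).
Local Notation V := (Vring K n).
Local Notation Vs := (Vstar K n).
Local Notation "u %:c" := (gconst (@d_rel K n 'I_n id) u) (at level 2, format "u %:c").
Let d_ i : Vs := ggen (d_rel id) i.
Let x_ i : V := ggen (x_rel id) i.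

Hypothesis sigma_eq : forall i j, h i j * Delta j (sigma i) = sigma i - sigma j.

Let dc i u : d_ i * u%:c = (Ubar_shift i 1 u)%:c * d_ i.
Proof. exact: (@d_const K n 'I_n (d_rel id) id). Qed.
Let dd i j : i != j -> d_ i * d_ j = (e_coef K i j)%:c * (d_ j * d_ i).
Proof. exact: (@d_swap K n 'I_n (d_rel id) id). Qed.
Let cM u v : (u * v)%:c = u%:c * v%:c.
Proof. exact: (rmorphM (gconst (d_rel id))). Qed.

(* Row [Some i] of the matrix of [a] holds the coefficients of
   [x^i a = sum_l twist a (Some i) (Some l) x^l + twist a (Some i) None];
   row [None] is [(a, 0)]. *)
Definition twist_entry (j : 'I_n) (a b : option 'I_n) : Vs :=
  match a, b with
  | None, None => d_ j
  | None, Some _ => 0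
  | Some i, None => - (sigma i)%:c *+ (i == j)
  | Some i, Some l =>
      if i == j then (a_coef K i l)%:c * d_ l else ((phi K i j)%:c * d_ j) *+ (i == l)
  end.

Definition twist_gen (j : 'I_n) : 'M[Vs]_n.+1 :=
  \matrix_(a, b) twist_entry j (unlift ord0 a) (unlift ord0 b).

(** The index [ord0] plays the role of [None]; the shift in row [Some i] is the one [u] undergoes in
    crossing [x^i] to its left. *)
Definition twist_const : {rmorphism U -> 'M[Vs]_n.+1} :=
  diag_morph (fun a => match unlift ord0 a with
    | None => gconst (d_rel id) : {rmorphism U -> Vs}
    | Some i => (gconst (d_rel id) \o Ubar_shift i (-1)) : {rmorphism U -> Vs}
    end).

Lemma twist_gen00 j : twist_gen j ord0 ord0 = d_ j.
Proof. by rewrite mxE unlift_none. Qed.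
Lemma twist_gen0S j l : twist_gen j ord0 (lift ord0 l) = 0.
Proof. by rewrite mxE unlift_none liftK. Qed.
Lemma twist_genS0 i j : twist_gen j (lift ord0 i) ord0 = - (sigma i)%:c *+ (i == j).
Proof. by rewrite mxE unlift_none liftK. Qed.
Lemma twist_genSS i j l : twist_gen j (lift ord0 i) (lift ord0 l) =
  if i == j then (a_coef K i l)%:c * d_ l else ((phi K i j)%:c * d_ j) *+ (i == l).
Proof. by rewrite mxE !liftK. Qed.

Lemma twist_mul0 j p (B : 'M[Vs]_(n.+1, p)) b : (twist_gen j *m B) ord0 b = d_ j * B ord0 b.
Proof.
rewrite mxE big_ord_recl twist_gen00 big1 ?addr0 // => l _.
by rewrite twist_gen0S mul0r.
Qed.

Lemma twist_mul_ne i j p (B : 'M[Vs]_(n.+1, p)) b : i != j ->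
  (twist_gen j *m B) (lift ord0 i) b = (phi K i j)%:c * d_ j * B (lift ord0 i) b.
Proof.
move=> ij; rewrite mxE big_ord_recl twist_genS0 (negbTE ij) mul0r add0r (bigD1 i) //=.
rewrite big1 ?addr0 => [|l li].
  by rewrite twist_genSS (negbTE ij) eqxx.
by rewrite twist_genSS (negbTE ij) eq_sym (negbTE li) mul0r.
Qed.

Lemma twist_mul_eq i p (B : 'M[Vs]_(n.+1, p)) b :
  (twist_gen i *m B) (lift ord0 i) b =
  \sum_l (a_coef K i l)%:c * d_ l * B (lift ord0 l) b - (sigma i)%:c * B ord0 b.
Proof.
rewrite mxE big_ord_recl twist_genS0 eqxx mulr1n mulNr addrC; congr (_ - _).
by apply: eq_bigr => l _; rewrite twist_genSS eqxx.
Qed.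

Lemma twist_weight j u v : v = Ubar_shift j (-1) u ->
  (forall i, Ubar_shift j 1 (Ubar_shift i (-1) v) = Ubar_shift i (-1) u) ->
  twist_const u * twist_gen j = twist_gen j * twist_const v.
Proof.
move=> ev sv; have ev' : Ubar_shift j 1 v = u by rewrite ev (Ubar_shiftK j (-1)).
apply/matrixP=> a b; rewrite diag_morph_mul mul_diag_morph !mxE.
case: (unliftP ord0 a) => [i|] _; case: (unliftP ord0 b) => [l|] _ /=; last first.
- by rewrite dc ev'.
- by rewrite mulr0 mul0r.
- case: eqP => [->|_]; last by rewrite mulr0 mul0r.
  by rewrite mulr1n mulrN mulNr -!cM mulrC ev.
case: eqP => [->|ij].
  (* In row [j], the shift attached to column [l] is undone by crossing [d_l], so every column
     leaves the same [v]. *)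
  by rewrite -mulrA dc (Ubar_shiftK l (-1)) !mulrA -!cM mulrC ev.
case: eqP => [<-|_]; last by rewrite mulr0 mul0r.
by rewrite mulr1n -mulrA dc sv !mulrA -!cM mulrC.
Qed.

(** This row encodes the overlap [x^j d_j d_k]. Column [None] is [sigma_dd], column [k] is
    [a_coef_dd0], and the other columns are [a_coef_dd]. *)
Lemma twist_row j k b : j != k ->
  (twist_gen j *m twist_gen k) (lift ord0 j) b =
  (Ubar_shift j (-1) (e_coef K j k))%:c * (twist_gen k *m twist_gen j) (lift ord0 j) b.
Proof.
move=> jk; rewrite twist_mul_eq twist_mul_ne // !mulrA -cM shift_e_phi //.
case: (unliftP ord0 b) => [l|] ->; last first.
  rewrite twist_gen00 twist_genS0 eqxx mulr1n (bigD1 k) //= twist_genS0 eqxx mulr1n.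
  rewrite big1 ?addr0 => [|l lk]; last by rewrite twist_genS0 (negbTE lk) mulr0.
  rewrite !mulrN -!mulrA !dc !mulrA -!cM -opprD -mulrDl -(rmorphD (gconst (d_rel id))).
  by rewrite sigma_dd.
rewrite twist_gen0S mulr0 subr0 twist_genSS eqxx (bigD1 k) //= twist_genSS eqxx.
rewrite -!mulrA (mulrA (d_ k)) dc (mulrA _ _ (d_ l)).
have [->|lk] := eqVneq l k.
  rewrite big1 ?addr0 => [|m mk]; last first.
    by rewrite twist_genSS (negbTE mk) mulr0.
  have -> : a_coef K k k = 1 by rewrite /a_coef hdiffxx subr0 divr1.
  rewrite shift1 rmorph1 mul1r (mulrA (d_ k)) dc !mulrA -cM.
  by rewrite -a_coef_dd0.
rewrite (bigD1 l) //= big1 ?addr0 => [|m /andP[mk ml]]; last first.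
  by rewrite twist_genSS (negbTE mk) (negbTE ml) mulr0.
rewrite twist_genSS (negbTE lk) eqxx mulr1n.
rewrite -!mulrA (mulrA (d_ l)) dc -(mulrA _ (d_ l)) (dd lk) (mulrA (d_ k)) dc.
rewrite !mulrA -!cM -!mulrDl -(rmorphD (gconst (d_rel id))).
by rewrite -(mulrA _ (Ubar_shift l 1 _)) shift_phi_e // a_coef_dd.
Qed.

(** Row [None] is the relation of [V^*] itself and row [j] is [twist_row]. Row [k] is [twist_row]
    with [j] and [k] exchanged, inverted by [e_coefK]; in the remaining rows [x^i] crosses both [d]
    by scalar factors. *)
Lemma twist_swap j k : j != k ->
  twist_gen j * twist_gen k = twist_const (e_coef K j k) * (twist_gen k * twist_gen j).
Proof.
move=> jk; have kj : k != j by rewrite eq_sym.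
apply/matrixP=> a b; rewrite diag_morph_mul.
case: (unliftP ord0 a) => [i|] ->; last first.
  rewrite !twist_mul0; case: (unliftP ord0 b) => [l|] ->.
    by rewrite !twist_gen0S !mulr0.
  by rewrite !twist_gen00 dd.
have [->|ij] := eqVneq i j; first by rewrite twist_row.
have [->|ik] := eqVneq i k.
  rewrite (twist_row b kj) /= mulrA -cM -shiftM e_coefK //.
  by rewrite shift1 rmorph1 mul1r.
rewrite !twist_mul_ne //= shift_e_coef0 //.
case: (unliftP ord0 b) => [l|] ->; last first.
  by rewrite !twist_genS0 (negbTE ij) (negbTE ik) !mulr0.
rewrite !twist_genSS (negbTE ij) (negbTE ik).
case: eqP => _; last by rewrite !mulr0.
rewrite !mulr1n -!mulrA (mulrA (d_ j)) dc (mulrA (d_ k)) dc.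
have ji : j != i by rewrite eq_sym.
have ki : k != i by rewrite eq_sym.
rewrite (shift_phi0 K 1 ji jk ik) (shift_phi0 K 1 ki kj ij).
rewrite -(mulrA _ (d_ j)) -(mulrA _ (d_ k)) dd // !mulrA -!cM.
by congr (_%:c * _ * _); rewrite mulrC [X in _ * X]mulrC mulrA.
Qed.

Lemma twist_rel s t : @d_rel K n _ id s t ->
  geval twist_const twist_gen s = geval twist_const twist_gen t.
Proof.
case=> [a j|i j|j k jk] /=.
- apply: twist_weight; first by rewrite shift_of shift_polyC.
  by move=> i; rewrite !(shift_of, shift_polyC).
- apply: twist_weight.
    by rewrite Ubar_shift_h; case: eqP => _; rewrite ?subr0 ?addr0.
  move=> l; rewrite shiftD shiftN shift_nat Ubar_shift_h !shiftD shiftN shift_nat.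
  rewrite Ubar_shift_h (rmorph_int (Ubar_shift j 1)) addrAC; congr (_ + _).
  by case: eqP => _; rewrite ?subr0 ?addr0 ?addrK.
rewrite twist_swap; last by rewrite neq_ltn jk.
by rewrite /e_coef jk.
Qed.

Definition twist : {rmorphism Vs -> 'M[Vs]_n.+1} := glift twist_rel.

Lemma twistc u : twist u%:c = twist_const u. Proof. exact: glift_const. Qed.
Lemma twistd j : twist (d_ j) = twist_gen j. Proof. exact: glift_gen. Qed.

(** This shape of the first row is preserved by products; it evaluates the entries [B ord0 b] left
    over by [twist_mul_eq]. *)
Lemma twist0 a : twist a ord0 ord0 = a /\ forall l, twist a ord0 (lift ord0 l) = 0.
Proof.
elim/presented_lind: a => [|a b [IHa Ia] [IHb Ib]|a [IHa Ia]|u a [IHa Ia]|j a [IHa Ia]].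
- by rewrite rmorph1; split=> [|l]; rewrite !mxE.
- by rewrite rmorphD; split=> [|l]; rewrite mxE ?IHa ?IHb // Ia Ib addr0.
- by rewrite rmorphN; split=> [|l]; rewrite mxE ?IHa // Ia oppr0.
- rewrite rmorphM twistc.
  by split=> [|l]; rewrite diag_morph_mul unlift_none ?IHa // Ia mulr0.
- by rewrite rmorphM twistd; split=> [|l]; rewrite twist_mul0 ?IHa // Ia mulr0.
Qed.

Local Notation M := (Vstar_Vring K n).
Local Notation "a ## b" := (pure (gconst (d_rel id) : {rmorphism U -> Vs})
  (gconst (x_rel id) : {rmorphism U -> V}) a b : M) (at level 45).

Let xc i u : x_ i * gconst (x_rel id) u = gconst (x_rel id) (Ubar_shift i (-1) u) * x_ i.
Proof. exact: (@x_const K n 'I_n (x_rel id) id). Qed.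

Lemma pure0l b : 0 ## b = 0.
Proof. by apply: (addrI (0 ## b)); rewrite -pureDl !addr0. Qed.
Lemma pureNl a b : (- a) ## b = - (a ## b).
Proof. by apply: (addrI (a ## b)); rewrite -pureDl !subrr pure0l. Qed.
Lemma pure_suml (I : finType) (F : I -> Vs) b : (\sum_i F i) ## b = \sum_i (F i ## b).
Proof. exact: (big_morph (fun a => a ## b) (fun a a' => pureDl _ _ a a' b) (pure0l b)). Qed.
Lemma scale_pure u a b : u *: (a ## b) = (u%:c * a) ## b.
Proof. exact: tscale_pure. Qed.
Lemma pure_const a u b : a ## (gconst (x_rel id) u * b) = (a * u%:c) ## b.
Proof. by rewrite pure_balanced. Qed.

(** The formula is [x^i a b] with [x^i a] reordered by [twist]. It is balanced because column [l]
    carries the shift that a coefficient undergoes in crossing [x^l]. *)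
Lemma actX_balanced i : balanced (gconst (d_rel id) : {rmorphism U -> Vs})
  (gconst (x_rel id) : {rmorphism U -> V})
  (fun a b => \sum_l (twist a (lift ord0 i) (lift ord0 l) ## (x_ l * b))
              + (twist a (lift ord0 i) ord0 ## b)).
Proof.
split=> [a a' b|a b b'|a u b].
- rewrite rmorphD !mxE pureDl addrACA -big_split /=; congr (_ + _).
  by apply: eq_bigr => l _; rewrite mxE pureDl.
- rewrite pureDr addrACA -big_split /=; congr (_ + _).
  by apply: eq_bigr => l _; rewrite mulrDr pureDr.
- rewrite rmorphM twistc mul_diag_morph unlift_none pure_const; congr (_ + _).
  by apply: eq_bigr => l _; rewrite mul_diag_morph liftK /= mulrA xc -mulrA pure_const.
Qed.

Lemma actD_balanced j : balanced (gconst (d_rel id) : {rmorphism U -> Vs})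
  (gconst (x_rel id) : {rmorphism U -> V}) (fun a b => (d_ j * a) ## b).
Proof.
split=> [a a' b|a b b'|a u b]; first by rewrite mulrDr pureDl.
- by rewrite pureDr.
- by rewrite mulrA pure_balanced.
Qed.

Definition actX i : {additive M -> M} := tlift (actX_balanced i).
Definition actD i : {additive M -> M} := tlift (actD_balanced i).

Lemma actXE i a b : actX i (a ## b) =
  \sum_l (twist a (lift ord0 i) (lift ord0 l) ## (x_ l * b))
    + (twist a (lift ord0 i) ord0 ## b).
Proof. exact: tlift_pure. Qed.
Lemma actDE i a b : actD i (a ## b) = (d_ i * a) ## b.
Proof. exact: tlift_pure. Qed.

(** The mixed relations are the rows of the product [twist (d_j * a) = twist_gen j * twist a]. *)
Lemma act_hsystem : hsystem sigma actX actD.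
Proof.
split=> [i u|i u|i j m ij|i].
- apply: tensor_ext => [x y|x y|a b]; try by rewrite !(raddfB, scalerBr).
  rewrite scale_pure !actXE rmorphM twistc !diag_morph_mul liftK scalerDr.
  rewrite scale_pure scaler_sumr.
  by congr (_ + _); apply: eq_bigr => l _; rewrite diag_morph_mul liftK scale_pure.
- apply: tensor_ext => [x y|x y|a b]; try by rewrite !(raddfB, scalerBr).
  by rewrite scale_pure !actDE scale_pure !mulrA dc.
- move: m; apply: tensor_ext => [x y|x y|a b]; try by rewrite !(raddfB, scalerBr).
  rewrite actDE !actXE rmorphM twistd twist_mul_ne // raddfD raddf_sum /= actDE scalerDr.
  rewrite scale_pure mulrA scaler_sumr; congr (_ + _); apply: eq_bigr => l _.
  by rewrite twist_mul_ne // actDE scale_pure mulrA.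
- apply: tensor_ext => [x y|x y|a b].
  + by rewrite !raddfB.
  + rewrite scalerBr [RHS]subrBB; congr (_ - _).
    by rewrite -sumrB; apply: eq_bigr => l _; rewrite !raddfB.
  rewrite actDE actXE rmorphM twistd twist_mul_eq (proj1 (twist0 a)).
  rewrite pureDl pureNl -scale_pure addrA; congr (_ - _).
  rewrite pure_suml -big_split /=.
  under eq_bigr => l _.
    rewrite twist_mul_eq (proj2 (twist0 a)) mulr0 subr0 pure_suml.
    over.
  rewrite big_split /= exchange_big /= -big_split; apply: eq_bigr => l _ /=.
  rewrite actXE raddfD raddf_sum /= scalerDr scaler_sumr; congr (_ + _).
    by apply: eq_bigr => m _; rewrite actDE scale_pure mulrA.
  by rewrite actDE scale_pure mulrA.
Qed.

Lemma actX_pure1 i b : actX i (1 ## b) = 1 ## (x_ i * b).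
Proof.
rewrite actXE rmorph1 (bigD1 i) //= big1 ?addr0 => [|k ki].
  by rewrite !mxE eqxx [lift _ _ == _]eq_sym eq_liftF pure0l addr0.
by rewrite mxE (inj_eq (@lift_inj _ _)) eq_sym (negbTE ki) pure0l.
Qed.

(** Induction on the left tensor factor: at 1 this is the relation of [V]. A new factor [d_k] with
    [k] equal to [i] or [j] is handled by [xx_defect] with [tau = 0]; any other [d_k] is crossed by
    scalar factors. *)
Lemma act_xx m : xx_commute actX m.
Proof.
move=> i j ij; move: m; have := act_hsystem => -[XZ DZ XDne XDeq].
apply: tensor_ext => [x y|x y|a b]; try by rewrite !(raddfB, scalerBr).
(* The pair [i, j] is quantified inside the induction because [xx_defect] uses the commutation for
   all pairs. *)
suff: forall i j, i != j -> forall b,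
    actX i (actX j (a ## b)) = c_coef K i j *: actX j (actX i (a ## b)).
  by apply.
move: {i j ij} a {b}; apply: presented_lind => [|a a' IH IH'|a IH|u a IH|k a IH] i j ij b.
- rewrite !actX_pure1 mulrA (@x_swap K n 'I_n (x_rel id) id) // -mulrA pure_const mul1r.
  by rewrite [RHS]scale_pure mulr1 mulrA.
- by rewrite pureDl !raddfD IH // IH' // scalerDr.
- by rewrite pureNl !raddfN IH // scalerN.
- rewrite -scale_pure !XZ IH // !scalerA; congr (_ *: _).
  by rewrite mulrC Ubar_shiftC.
rewrite -actDE; have [<-|jk] := eqVneq j k.
  apply/eqP; rewrite -subr_eq0; apply/eqP.
  rewrite (xx_defect act_hsystem _ ij); last by move=> ? ? ?; apply: IH.
  by rewrite (tau_eq0 _ ij).2 ?scale0r.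
have [<-|ik] := eqVneq i k.
  have ji : j != i by rewrite eq_sym.
  have : actX j (actX i (actD i (a ## b))) =
      c_coef K j i *: actX i (actX j (actD i (a ## b))).
    apply/eqP; rewrite -subr_eq0; apply/eqP.
    rewrite (xx_defect act_hsystem _ ji); last by move=> ? ? ?; apply: IH.
    by rewrite (tau_eq0 _ ji).2 ?scale0r.
  by move=> ->; rewrite scalerA c_coefK // scale1r.
have e p q : p != k -> q != k -> p != q -> actX p (actX q (actD k (a ## b))) =
    (phi K q k * phi K p k) *: actD k (actX p (actX q (a ## b))).
  move=> pk qk pq; rewrite (XDne q k) // XZ (XDne p k) // scalerA.
  by rewrite (shift_phi0 K (-1) pq pk qk).
have ki : k != i by rewrite eq_sym.
have kj : k != j by rewrite eq_sym.
rewrite e // e // 1?eq_sym // IH // DZ !scalerA (shift_c_coef0 K 1 ki kj ij).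
by congr (_ *: _); rewrite mulrC [phi K i k * _]mulrC.
Qed.

Local Notation r := (diff_rel sigma).

Definition act_gen (g : gens n) : M -> M :=
  match g with Xgen i => actX i | Dgen i => actD i end.
Local Notation act := (gact (fun u (m : M) => u *: m) act_gen).

Lemma act_rel s t : r s t -> forall m, act s m = act t m.
Proof.
have [XZ DZ XDne XDeq] := act_hsystem.
case=> {s t} [s t|s t|i j ij|i j ij|i] => [[a j|i j|i j ij]|[a j|i j|i j ij]|||] m /=.
- by rewrite XZ shift_of shift_polyC.
- rewrite XZ shiftD shift_nat Ubar_shift_h; congr (_ *: _).
  by case: eqP => _; rewrite ?addr0 // mulrNz subrK.
- by rewrite act_xx /c_coef ?ij // neq_ltn ij.
- by rewrite DZ shift_of shift_polyC.
- rewrite DZ shiftD shiftN shift_nat Ubar_shift_h; congr (_ *: _).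
  by case: eqP => _; rewrite ?addr0 ?subr0 // addrK.
- move: m; apply: tensor_ext => [x y|x y|a b]; try by rewrite !raddfB.
  rewrite !actDE scale_pure !mulrA (@dd i j) ?neq_ltn ?ij //.
  by rewrite /e_coef ij !mulrA.
- by rewrite XDne /phi ?ij ?scale1r // neq_ltn ij.
- by rewrite XDne /phi ?ltnNge ?(ltnW ij) // neq_ltn ij orbT.
rewrite XDeq; congr (_ - _).
by rewrite (big_morph (fun t => act t m) (fun s t => erefl)
  (scale0r m : act (TConst 0) m = 0)).
Qed.

Local Notation T := (Diff sigma).
Local Notation F := (@PBW_mult K n sigma).

Let to_Diff a b : F (a ## b) = Vstar_to_Diff sigma a * Vring_to_Diff sigma b.
Proof. exact: tlift_pure. Qed.
Let Vsc u : Vstar_to_Diff sigma u%:c = gconst r u. Proof. exact: glift_const. Qed.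
Let Vsd i : Vstar_to_Diff sigma (d_ i) = ggen r (Dgen i). Proof. exact: glift_gen. Qed.
Let Vc u : Vring_to_Diff sigma (gconst (x_rel id) u) = gconst r u.
Proof. exact: glift_const. Qed.
Let Vx i : Vring_to_Diff sigma (x_ i) = ggen r (Xgen i). Proof. exact: glift_gen. Qed.

Let FZ u m : F (u *: m) = u *: F m. Proof. exact: mult_scalable. Qed.

Lemma PBW_mult_actD j m : F (actD j m) = ggen r (Dgen j) * F m.
Proof.
move: m; apply: tensor_ext => [x y|x y|a b].
- by rewrite !raddfB.
- by rewrite raddfB mulrBr.
- by rewrite actDE !to_Diff rmorphM Vsd mulrA.
Qed.

(** The operators on both sides form an [hsystem] for the same [sigma], so agreement on the vectors
    [1 (x) b] propagates through each [d_k] on the left. *)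
Lemma PBW_mult_actX i m : F (actX i m) = ggen r (Xgen i) * F m.
Proof.
have [XZ DZ XDne XDeq] := act_hsystem.
have [YZ EZ YEne YEeq] := Diff_hsystem sigma.
move: m; apply: tensor_ext => [x y|x y|a b].
- by rewrite !raddfB.
- by rewrite raddfB mulrBr.
move: a i b; apply: presented_lind => [|a a' IH IH'|a IH|u a IH|k a IH] i b.
- by rewrite actX_pure1 !to_Diff !rmorph1 !mul1r rmorphM Vx.
- by rewrite pureDl !raddfD /= IH IH' mulrDr.
- by rewrite pureNl !raddfN /= IH mulrN.
- by rewrite -scale_pure XZ !FZ IH; exact/esym/YZ.
rewrite -actDE PBW_mult_actD; have [<-|ik] := eqVneq i k; last first.
  by rewrite XDne // FZ PBW_mult_actD IH; exact/esym/YEne.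
rewrite XDeq raddfB raddf_sum /= FZ; apply/esym; rewrite [LHS]YEeq.
by congr (_ - _); apply: eq_bigr => l _; rewrite FZ PBW_mult_actD IH.
Qed.

Lemma PBW_mult_act t m : F (act t m) = gclass r t * F m.
Proof.
elim: t m => [u|[i|i]|s IHs t IHt|s IHs|s IHs t IHt] m /=.
- exact: FZ.
- exact: PBW_mult_actX.
- exact: PBW_mult_actD.
- by rewrite raddfD /= IHs IHt gclass_add mulrDl.
- by rewrite raddfN /= IHs gclass_opp mulNr.
- by rewrite IHs IHt gclass_mul mulrA.
Qed.

Let cB (u : U) : zmod_morphism (fun m : M => u *: m).
Proof. by move=> x y; rewrite scalerBr. Qed.
Let gB g : zmod_morphism (act_gen g).
Proof. by case: g => i x y; rewrite /= raddfB. Qed.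
Let c1 (m : M) : 1 *: m = m. Proof. exact: scale1r. Qed.
Let cD (u v : U) (m : M) : (u + v) *: m = u *: m + v *: m. Proof. exact: scalerDl. Qed.
Let cZ (u v : U) (m : M) : (u * v) *: m = u *: (v *: m). Proof. by rewrite scalerA. Qed.

Definition Diff_act : T -> M -> M := pact (fun u (m : M) => u *: m) act_gen.
Let actM y z m : Diff_act (y * z) m = Diff_act y (Diff_act z m).
Proof. exact: (pactM cB gB c1 cD cZ act_rel). Qed.
Let actP y z m : Diff_act (y + z) m = Diff_act y m + Diff_act z m.
Proof. exact: (pactD cB gB c1 cD cZ act_rel). Qed.
Let actN y m : Diff_act (- y) m = - Diff_act y m.
Proof. exact: (pactN cB gB c1 cD cZ act_rel). Qed.
Let act1 m : Diff_act 1 m = m.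
Proof. exact: (pact1 cB gB c1 cD cZ act_rel). Qed.
Let actc u m : Diff_act (gconst r u) m = u *: m.
Proof. exact: (pact_const cB gB c1 cD cZ act_rel). Qed.
Let actg g m : Diff_act (ggen r g) m = act_gen g m.
Proof. exact: (pact_gen cB gB c1 cD cZ act_rel). Qed.

Lemma Diff_act_Vstar a b : Diff_act (Vstar_to_Diff sigma a) (1 ## b) = a ## b.
Proof.
elim/presented_lind: a => [|a a' IH IH'|a IH|u a IH|j a IH].
- by rewrite rmorph1 act1.
- by rewrite rmorphD actP IH IH' pureDl.
- by rewrite rmorphN actN IH pureNl.
- by rewrite rmorphM actM IH Vsc actc scale_pure.
- by rewrite rmorphM actM IH Vsd actg /= actDE.
Qed.

Lemma Diff_act_Vring b : Diff_act (Vring_to_Diff sigma b) (1 ## 1) = 1 ## b.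
Proof.
elim/presented_lind: b => [|a a' IH IH'|a IH|u a IH|j a IH].
- by rewrite rmorph1 act1.
- by rewrite rmorphD actP IH IH' pureDr.
- rewrite rmorphN actN IH; apply: (addrI (1 ## a)).
  by rewrite -pureDr !subrr; apply: (addrI (1 ## 0)); rewrite -pureDr !addr0.
- by rewrite rmorphM actM IH Vc actc scale_pure pure_const mul1r mulr1.
- by rewrite rmorphM actM IH Vx actg /= actX_pure1.
Qed.

(** Acting on [1 (x) 1] by the image of [b] and then of [a] rebuilds [a (x) b]; the other composite
    is the identity because multiplication commutes with the actions, by [PBW_mult_act]. *)
Lemma sigma_eq_PBW : PBW sigma.
Proof.
have FK m : Diff_act (F m) (1 ## 1) = m.
  move: m; apply: tensor_ext => [x y|//|a b].
    by rewrite (mult_zmod_morphism sigma x y) actP actN.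
  by rewrite to_Diff actM Diff_act_Vring Diff_act_Vstar.
exists (fun y => Diff_act y (1 ## 1)) => [|y]; first exact: FK.
have -> : Diff_act y (1 ## 1) = act (grepr y) (1 ## 1) by [].
apply: etrans (PBW_mult_act _ _) _.
by rewrite greprK to_Diff !rmorph1 !mulr1.
Qed.
End TwistedAction.

Theorem proposition3p1 (K : fieldType) (charK : [pchar K] =i pred0)
    (n : nat) (n_gt0 : (0 < n)%N) (sigma : 'I_n -> Ubar K n) :
  PBW sigma <->
  (forall i j : 'I_n,
     hdiff K i j * Delta j (sigma i) = sigma i - sigma j).
Proof.
split=> [pbw i j|]; last exact: sigma_eq_PBW.
have [->|ij] := eqVneq i j; first by rewrite hdiffxx mul0r subrr.
have ji : j != i by rewrite eq_sym.
(* The equation for [sigma i] and the shift of [h_j] corresponds to [tau j i], hence the exchanged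
   indices. *)
by apply/(tau_eq0 sigma ji)/(PBW_tau0 pbw).
Qed.
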